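(* Let $q$ be a primitive integral isotropic ternary quadratic form with $\Delta=\Delta(q)>0$. Then there is a positive integer $K\le\tau(\Delta)$, nonsingular $3\times3$ integer matrices $M_1,\ldots,M_K$ and positive integers $D_1,\dots,D_K$ such that: (a) if $\Delta$ is square-free then $K=\tau(\Delta)$; each $\det(M_k)$ is a positive divisor of $\Delta$; every primitive integral solution $\mathbf{x}$ of $q(\mathbf{x})=0$ lies in $M_k(\mathbb{Z}^3)$ for exactly one $k$; $q(M_k\mathbf{x})=D_k(x_1x_3-x_2^2)$ identically; $\Delta\det(M_k)^2=D_k^3$, $D_k\mid\Delta$, $\det(M_k)\mid D_k$ and $D_k\mid\det(M_k)^2$; a prime $p$ divides $\Delta\det(M_k)^{-1}$ only if $v_p(\Delta)\ge4$; and if $\Delta$ is cube-free then each $M_k(\mathbb{Z}^3)$ contains a primitive zero of $q$; (b) for each $k$, if $M_k^{-1}$ has rows $\mathbf{r}_1,\mathbf{r}_2,\mathbf{r}_3$ then $\|\mathbf{r}_1\|\cdot\|\mathbf{r}_3\|\le 9D_k^{-1}\|q\|$ and $\|\mathbf{r}_2\|^2\le 10D_k^{-1}\|q\|$; (c) for each $k$, if $M_k$ has columns $\mathbf{c}_1,\mathbf{c}_2,\mathbf{c}_3$ then $\|\mathbf{c}_1\|\le\|\mathbf{c}_3\|$, $\|\mathbf{c}_1\|\cdot\|\mathbf{c}_3\|\le 90\det(M_k)^2D_k^{-2}\|q\|^2\le 90\|q\|^2$, and $\|\mathbf{c}_2\|\le 9\det(M_k)D_k^{-1}\|q\|\le 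9\|q\|$.
   Context: A ternary quadratic form $q(\mathbf{x})=\sum_{1\le i\le j\le 3}q_{ij}x_ix_j$ is integral if all $q_{ij}\in\mathbb{Z}$, primitive if $\gcd(q_{ij})=1$, isotropic if $q(\mathbf{x})=0$ has a nonzero integer solution. Its matrix is $Q=\begin{pmatrix}2q_{11}&q_{12}&q_{13}\\ q_{12}&2q_{22}&q_{23}\\ q_{13}&q_{23}&2q_{33}\end{pmatrix}$, $\Delta(q)=\tfrac12\det Q$, and $\|q\|$ is the Euclidean (Frobenius) norm of $Q$, i.e. $\|q\|=(4q_{11}^2+2q_{12}^2+2q_{13}^2+4q_{22}^2+2q_{23}^2+4q_{33}^2)^{1/2}$. $\|\cdot\|$ on vectors is the Euclidean norm. $\tau$ is the divisor function, $v_p$ the $p$-adic valuation. *)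

(* Defs.v *)
From HB Require Import structures.
From mathcomp Require Import all_boot all_order all_algebra.
From mathcomp Require Import ring.
Set Implicit Arguments.
Unset Strict Implicit.
Unset Printing Implicit Defensive.
Import Order.TTheory GRing.Theory Num.Theory.
Local Open Scope ring_scope.

(* The form q11 x1^2 + q12 x1 x2 + q13 x1 x3 + q22 x2^2 + q23 x2 x3 + q33 x3^2;
   the coordinates x1, x2, x3 are indexed by 0, 1, 2 : 'I_3. *)
Record tqform := TQForm {
  q11 : int; q12 : int; q13 : int; q22 : int; q23 : int; q33 : int }.

Definition tqeval (q : tqform) (x : 'cV[int]_3) : int :=
  q11 q * x 0 0 ^+ 2 + q12 q * x 0 0 * x 1 0 + q13 q * x 0 0 * x 2 0
  + q22 q * x 1 0 ^+ 2 + q23 q * x 1 0 * x 2 0 + q33 q * x 2 0 ^+ 2.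

Definition tqcoefs (q : tqform) : seq int :=
  [:: q11 q; q12 q; q13 q; q22 q; q23 q; q33 q].

Definition tqprimitive (q : tqform) : Prop :=
  \big[gcdn/0%N]_(c <- tqcoefs q) absz c = 1%N.

Definition isotropic (q : tqform) : Prop :=
  exists x : 'cV[int]_3, x != 0 /\ tqeval q x = 0.

Definition tqmx (q : tqform) : 'M[int]_3 :=
  \matrix_(i < 3, j < 3)
    nth 0 (nth [::] [:: [:: 2 * q11 q; q12 q; q13 q];
                        [:: q12 q; 2 * q22 q; q23 q];
                        [:: q13 q; q23 q; 2 * q33 q]] i) j.

(* The division is exact: see tqdiscE. *)
Definition tqdisc (q : tqform) : int := (\det (tqmx q) %/ 2)%Z.

Lemma tqdet (q : tqform) :
  \det (tqmx q) =
  (4 * q11 q * q22 q * q33 q + q12 q * q13 q * q23 q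
   - q11 q * q23 q ^+ 2 - q22 q * q13 q ^+ 2 - q33 q * q12 q ^+ 2) * 2.
Proof.
rewrite (expand_det_row _ 0) !big_ord_recl big_ord0 /cofactor.
rewrite !(expand_det_row _ 0) !big_ord_recl !big_ord0 /cofactor !det_mx11 !mxE /=.
by ring.
Qed.

Lemma tqdiscE (q : tqform) : tqdisc q * 2 = \det (tqmx q).
Proof. by rewrite /tqdisc tqdet mulzK. Qed.

Definition vprimitive (x : 'cV[int]_3) : Prop :=
  \big[gcdn/0%N]_(i < 3) absz (x i 0) = 1%N.

Definition primitive_zero (q : tqform) (x : 'cV[int]_3) : Prop :=
  vprimitive x /\ tqeval q x = 0.

Definition in_lattice (M : 'M[int]_3) (x : 'cV[int]_3) : Prop :=
  exists y : 'cV[int]_3, x = M *m y.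

Definition powerfree (e n : nat) : Prop :=
  forall p : nat, prime p -> ~~ (p ^ e %| n)%N.

Definition tau (n : nat) : nat := size (divisors n).

(* On row and column vectors this is the Euclidean norm. *)
Definition fnorm (R : rcfType) (m n : nat) (A : 'M[R]_(m, n)) : R :=
  Num.sqrt (\sum_(i < m) \sum_(j < n) A i j ^+ 2).

Definition mxR (R : rcfType) (m n : nat) (A : 'M[int]_(m, n)) : 'M[R]_(m, n) :=
  map_mx intr A.

Definition tqnorm (R : rcfType) (q : tqform) : R := fnorm (mxR R (tqmx q)).

(* Main.v *)
(* A triple of columns [a, b, c] with q(y1 a + y2 b + y3 c) = D (y1 y3 - y2^2)
   parametrises the zeros of [q] by phi(X, Y) = X^2 a + X Y b + Y^2 c. Lines through
   one zero give such a frame with D = Delta. Among the frames with D | Delta choose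
   one with D minimal and then with the content N of its first column maximal,
   writing that column N a. Minimality and maximality force the content of
   phi(X, Y), for coprime X and Y, to be exactly gcd(N, Y). Hence the zero
   phi(X, Y) / gcd(N, Y) lies in the lattice spanned by (N / h) a, b, h c, where
   h | N, for h = gcd(N, Y) only.

   For the norm bounds, let B be the largest absolute value of an entry of Q.
   Since Q (7 B - 2 Q) has positive determinant, it is not negative semidefinite, so
   |Q e|^2 < 7 B q(e) for some integer vector e. The coordinates of e in a frame form a
   definite binary quadratic form, which SL2(Z) reduces without changing the
   lattice; for a reduced frame the majorant of q attached to e bounds the rows of
   the inverse matrix, and cross products of these rows give the columns. *)
Require Import Defs.
From HB Require Import structures.
From mathcomp Require Import all_boot all_order all_algebra.
From mathcomp Require Import ring lra zify.
From Stdlib Require Import Classical.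
Set Implicit Arguments.
Unset Strict Implicit.
Unset Printing Implicit Defensive.
Import Order.TTheory GRing.Theory Num.Theory.
Local Open Scope ring_scope.

(** * Ternary forms under substitution, and frames *)

Lemma ord3P (P : 'I_3 -> Prop) : P 0 -> P 1 -> P 2 -> forall i, P i.
Proof.
move=> P0 P1 P2 [[|[|[|//]]] lti].
- by rewrite (_ : Ordinal lti = 0) //; apply: val_inj.
- by rewrite (_ : Ordinal lti = 1) //; apply: val_inj.
- by rewrite (_ : Ordinal lti = 2) //; apply: val_inj.
Qed.

Lemma sum3 (V : nmodType) (F : 'I_3 -> V) : \sum_i F i = F 0 + F 1 + F 2.
Proof.
rewrite !big_ord_recl big_ord0 addr0 addrA.
by congr (_ + F _ + F _); apply: val_inj.
Qed.

Lemma det3 (S : comNzRingType) (A : 'M[S]_3) :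
  \det A = A 0 0 * (A 1 1 * A 2 2 - A 1 2 * A 2 1)
         - A 0 1 * (A 1 0 * A 2 2 - A 1 2 * A 2 0)
         + A 0 2 * (A 1 0 * A 2 1 - A 1 1 * A 2 0).
Proof.
(* Indexing by natural numbers lets the lifted ordinals of the cofactor expansions compute to common
   terms. *)
pose f (i j : nat) := A (inord i) (inord j).
have fE i j : A i j = f i j by rewrite /f !inord_val.
rewrite (expand_det_row _ 0) !big_ord_recl big_ord0 /cofactor.
rewrite !(expand_det_row _ 0) !big_ord_recl !big_ord0 /cofactor !det_mx11 !mxE.
by rewrite !fE /=; ring.
Qed.

Implicit Types (q : tqform) (x y a b c : 'cV[int]_3).

Definition polar q x y : int :=
  2 * q11 q * x 0 0 * y 0 0 + 2 * q22 q * x 1 0 * y 1 0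
  + 2 * q33 q * x 2 0 * y 2 0
  + q12 q * (x 0 0 * y 1 0 + x 1 0 * y 0 0)
  + q13 q * (x 0 0 * y 2 0 + x 2 0 * y 0 0)
  + q23 q * (x 1 0 * y 2 0 + x 2 0 * y 1 0).

Lemma tqevalD q x y : tqeval q (x + y) = tqeval q x + tqeval q y + polar q x y.
Proof. by rewrite /tqeval /polar !mxE; ring. Qed.

Lemma tqevalZ q (s : int) x : tqeval q (s *: x) = s ^+ 2 * tqeval q x.
Proof. by rewrite /tqeval !mxE; ring. Qed.

Lemma polarC q x y : polar q x y = polar q y x.
Proof. by rewrite /polar; ring. Qed.

Lemma polarDl q x y z : polar q (x + y) z = polar q x z + polar q y z.
Proof. by rewrite /polar !mxE; ring. Qed.

Lemma polarDr q x y z : polar q z (x + y) = polar q z x + polar q z y.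
Proof. by rewrite /polar !mxE; ring. Qed.

Lemma polarZl q (s : int) x y : polar q (s *: x) y = s * polar q x y.
Proof. by rewrite /polar !mxE; ring. Qed.

Lemma polarZr q (s : int) x y : polar q x (s *: y) = s * polar q x y.
Proof. by rewrite /polar !mxE; ring. Qed.

Lemma polarxx q x : polar q x x = 2 * tqeval q x.
Proof. by rewrite /polar /tqeval; ring. Qed.

Definition polarE := (tqevalD, polarDl, polarDr, tqevalZ, polarZl, polarZr, polarxx).

Definition tqpull q (M : 'M[int]_3) : tqform :=
  TQForm (tqeval q (col 0 M)) (polar q (col 0 M) (col 1 M))
         (polar q (col 0 M) (col 2 M)) (tqeval q (col 1 M))
         (polar q (col 1 M) (col 2 M)) (tqeval q (col 2 M)).

Lemma tqeval_pull q M x : tqeval (tqpull q M) x = tqeval q (M *m x).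
Proof. by rewrite /tqeval /tqpull /= /polar /tqeval !mxE !sum3; ring. Qed.

Lemma tqmx_pull q M : tqmx (tqpull q M) = M^T *m tqmx q *m M.
Proof.
apply/matrixP; apply: ord3P; apply: ord3P.
all: rewrite !mxE !sum3 !mxE !sum3 !mxE /= /tqeval /polar !mxE; ring.
Qed.

Lemma tqdiscD q : tqdisc q =
  4 * q11 q * q22 q * q33 q + q12 q * q13 q * q23 q
   - q11 q * q23 q ^+ 2 - q22 q * q13 q ^+ 2 - q33 q * q12 q ^+ 2.
Proof. by rewrite /tqdisc tqdet mulzK. Qed.

Lemma tqdisc_pull q M : tqdisc (tqpull q M) = tqdisc q * \det M ^+ 2.
Proof.
apply: (@mulIf _ (2 : int)) => //.
rewrite tqdiscE tqmx_pull !det_mulmx det_tr -tqdiscE; ring.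
Qed.

Definition mx3 a b c : 'M[int]_3 :=
  \matrix_(i, j) (if j == 0 then a i 0 else if j == 1 then b i 0 else c i 0).

Lemma col0_mx3 a b c : col 0 (mx3 a b c) = a.
Proof. by apply/matrixP=> i j; rewrite !mxE ord1. Qed.

Lemma col1_mx3 a b c : col 1 (mx3 a b c) = b.
Proof. by apply/matrixP=> i j; rewrite !mxE ord1. Qed.

Lemma col2_mx3 a b c : col 2 (mx3 a b c) = c.
Proof. by apply/matrixP=> i j; rewrite !mxE ord1. Qed.

Lemma mul_mx3 a b c y : mx3 a b c *m y = y 0 0 *: a + y 1 0 *: b + y 2 0 *: c.
Proof. by apply/matrixP=> i j; rewrite !ord1 !mxE sum3 !mxE /=; ring. Qed.

(* The columns of a matrix [M] with q (M y) = D (y1 y3 - y2 ^ 2). *)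
Definition frame q (D : int) a b c : Prop :=
  [/\ tqeval q a = 0, tqeval q c = 0, tqeval q b = - D &
      [/\ polar q a b = 0, polar q b c = 0 & polar q a c = D]].

Lemma frame_pull q D a b c : frame q D a b c ->
  tqpull q (mx3 a b c) = TQForm 0 0 D (- D) 0 0.
Proof.
by case=> qa qc qb [ab bc ac]; rewrite /tqpull col0_mx3 col1_mx3 col2_mx3 qa qb qc ab bc ac.
Qed.

Lemma frame_eval q D a b c y : frame q D a b c ->
  tqeval q (mx3 a b c *m y) = D * (y 0 0 * y 2 0 - y 1 0 ^+ 2).
Proof. by move=> F; rewrite -tqeval_pull (frame_pull F) /tqeval /=; ring. Qed.

(** [D (y1 y3 - y2 ^ 2)] has discriminant [D ^ 3], and a substitution multiplies the discriminant by
    the square of its determinant. *)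
Lemma frame_disc q D a b c : frame q D a b c ->
  tqdisc q * \det (mx3 a b c) ^+ 2 = D ^+ 3.
Proof. by move=> F; rewrite -tqdisc_pull (frame_pull F) tqdiscD /=; ring. Qed.

Lemma frame_N q D a b c : frame q D a b c -> frame q D (- a) (- b) (- c).
Proof.
move=> [qa qc qb [ab bc ac]]; rewrite -!scaleN1r.
have [ba [cb ca]] : polar q b a = 0 /\ polar q c b = 0 /\ polar q c a = D.
  by rewrite !(polarC _ _ a) (polarC _ c b).
by split; [| | |split]; rewrite ?polarE ?qa ?qb ?qc ?ab ?ba ?bc ?cb ?ac ?ca //; ring.
Qed.

(** SL2(Z) acts on frames through the binary form [X ^ 2 a + X Y b + Y ^ 2 c]: [(X, Y) -> (Y, - X)]
    gives this frame, [X -> X + u Y] gives [frame_upper] and [Y -> Y + u X] gives [frame_lower]. *)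
Lemma frame_swap q D a b c : frame q D a b c -> frame q D c (- b) a.
Proof.
move=> [qa qc qb [ab bc ac]]; rewrite -!scaleN1r.
have [ba [cb ca]] : polar q b a = 0 /\ polar q c b = 0 /\ polar q c a = D.
  by rewrite !(polarC _ _ a) (polarC _ c b).
by split; [| | |split]; rewrite ?polarE ?qa ?qb ?qc ?ab ?ba ?bc ?cb ?ac ?ca //; ring.
Qed.

Lemma frame_upper q D a b c (u : int) : frame q D a b c ->
  frame q D a (b + (2 * u) *: a) (c + u *: b + u ^+ 2 *: a).
Proof.
move=> [qa qc qb [ab bc ac]].
have [ba [cb ca]] : polar q b a = 0 /\ polar q c b = 0 /\ polar q c a = D.
  by rewrite !(polarC _ _ a) (polarC _ c b).
by split; [| | |split]; rewrite ?polarE ?qa ?qb ?qc ?ab ?ba ?bc ?cb ?ac ?ca //; ring.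
Qed.

Lemma frame_lower q D a b c (u : int) : frame q D a b c ->
  frame q D (a + u *: b + u ^+ 2 *: c) (b + (2 * u) *: c) c.
Proof.
move=> [qa qc qb [ab bc ac]].
have [ba [cb ca]] : polar q b a = 0 /\ polar q c b = 0 /\ polar q c a = D.
  by rewrite !(polarC _ _ a) (polarC _ c b).
by split; [| | |split]; rewrite ?polarE ?qa ?qb ?qc ?ab ?ba ?bc ?cb ?ac ?ca //; ring.
Qed.

(** Moving the factor [p] between the isotropic columns keeps their pairing, hence [D]. For a prime
    [p] this is the passage to a neighbouring lattice. *)
Lemma frame_shift q D (p : int) a b c : p != 0 ->
  frame q D a b (p *: c) -> frame q D (p *: a) b c.
Proof.
move=> p0 [qa /eqP qc qb [ab /eqP bc ac]].
rewrite tqevalZ mulf_eq0 expf_eq0 (negPf p0) /= in qc.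
rewrite polarZr mulf_eq0 (negPf p0) /= in bc.
rewrite polarZr in ac.
split; rewrite ?tqevalZ ?qa ?(eqP qc) ?mulr0 //.
by split; rewrite ?polarZl ?ab ?mulr0 //; apply/eqP.
Qed.

Lemma frame_divide q D (p : int) a b c : p != 0 ->
  frame q D (p *: a) (p *: b) (p *: c) ->
  exists2 D', D = p ^+ 2 * D' & frame q D' a b c.
Proof.
move=> p0 [/eqP qa /eqP qc qb [/eqP ab /eqP bc ac]].
rewrite tqevalZ mulf_eq0 sqrf_eq0 (negPf p0) /= in qa.
rewrite tqevalZ mulf_eq0 sqrf_eq0 (negPf p0) /= in qc.
rewrite !(polarZl, polarZr) !mulf_eq0 (negPf p0) /= in ab bc.
rewrite tqevalZ in qb; rewrite polarZl polarZr in ac.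
exists (polar q a c); first by rewrite -ac; ring.
split; rewrite ?(eqP qa) ?(eqP qc) //; last by rewrite (eqP ab) (eqP bc).
have p2 : p ^+ 2 != 0 by rewrite expf_eq0 p0.
by apply: (mulfI p2); rewrite qb -ac; ring.
Qed.

(** * Existence and extremality of frames *)

Lemma unimodular_sqr n (L : 'M[int]_n) : L \in unitmx -> \det L ^+ 2 = 1.
Proof.
by rewrite unitmxE => /orP[] /eqP ->; rewrite ?sqrrN expr1n.
Qed.

(** The Smith normal form of the column [x] writes it as a multiple of the first column of a
    unimodular matrix, and that column inherits the vanishing of [q]. *)
Lemma isotropic_unimodular q : isotropic q ->
  exists2 L : 'M[int]_3, \det L ^+ 2 = 1 & tqeval q (col 0 L) = 0.
Proof.
case=> x [x0 qx].
have [L uL [R uR [d _ xE]]] := int_Smith_normal_form x.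
exists L; first exact: unimodular_sqr.
have {}xE : x = (d`_0 * R 0 0) *: col 0 L.
  apply/matrixP=> i j; rewrite ord1 xE !mxE big_ord_recl big_ord0 addr0 !mxE sum3.
  by rewrite !mxE /= mulr0n mulr1n; ring.
move/eqP: qx; rewrite xE tqevalZ mulf_eq0 sqrf_eq0 => /orP[] /eqP // s0.
by rewrite xE s0 scale0r eqxx in x0.
Qed.

(* The second intersections with the conic of the lines through an isotropic
   vector [v0] are [q v v0 - B(v0, v) v]; they are the values at [(X, Y)] of the
   binary quadratic form whose coefficients are these columns. *)
Lemma isotropic_frame q : isotropic q ->
  exists a b c, frame q (tqdisc q) a b c.
Proof.
case/isotropic_unimodular=> L dL q0.
(* [L] is unimodular, so the discriminant can be computed in the basis of its columns, where the
   first coefficient vanishes. *)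
have := tqdisc_pull q L; rewrite dL mulr1 => <-; rewrite tqdiscD /= q0.
move: q0; set v0 := col 0 L; set v1 := col 1 L; set v2 := col 2 L => q0.
exists (tqeval q v1 *: v0 + - polar q v0 v1 *: v1).
exists (polar q v1 v2 *: v0 + - polar q v0 v1 *: v2 + - polar q v0 v2 *: v1).
exists (tqeval q v2 *: v0 + - polar q v0 v2 *: v2).
have := polarC q v1 v0; have := polarC q v2 v0; have := polarC q v2 v1.
move=> E1 E2 E3.
by split; [| | |split]; rewrite !polarE ?q0 ?E1 ?E2 ?E3; ring.
Qed.

Definition dvdv (d : int) x : Prop := forall i, (d %| x i 0%R)%Z.

Lemma dvdvP d x : dvdv d x <-> exists y, x = d *: y.
Proof.
split=> [dx|[y ->] i]; last by rewrite mxE dvdz_mulr.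
exists (\col_i (x i 0%R %/ d)%Z); apply/matrixP=> i j.
by rewrite ord1 !mxE mulrC divzK.
Qed.

Lemma dvdvD d x y : dvdv d x -> dvdv d y -> dvdv d (x + y).
Proof. by move=> dx dy i; rewrite mxE rpredD. Qed.

Lemma dvdvZr d s x : dvdv d x -> dvdv d (s *: x).
Proof. by move=> dx i; rewrite mxE dvdz_mull. Qed.

Lemma dvdvZl d s x : (d %| s)%Z -> dvdv d (s *: x).
Proof. by move=> ds i; rewrite mxE dvdz_mulr. Qed.

Lemma dvdv_trans d d' x : (d %| d')%Z -> dvdv d' x -> dvdv d x.
Proof. by move=> dd' dx i; apply: dvdz_trans (dx i). Qed.

Lemma dvdv_Gauss d s x : coprimez d s -> dvdv d (s *: x) -> dvdv d x.
Proof. by move=> ds dx i; have := dx i; rewrite mxE Gauss_dvdzr. Qed.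

Lemma coprime_primez (p : nat) (s : int) : prime p ->
  coprimez p s = ~~ (p %| s)%Z.
Proof. by move=> pp; rewrite coprimezE prime_coprime. Qed.

Lemma dvdz_primeM (p : nat) (s t : int) : prime p ->
  (p %| s * t)%Z = (p %| s)%Z || (p %| t)%Z.
Proof. by move=> pp; rewrite !dvdzE abszM Euclid_dvdM. Qed.

Lemma prime_neq0z (p : nat) : prime p -> p%:Z != 0.
Proof. by case: p. Qed.

Lemma inverse_modz (m s : int) : coprimez m s -> exists t, (m %| t * s - 1)%Z.
Proof.
case/coprimezP=> [[u v] /= E]; exists v.
by rewrite (_ : v * s - 1 = - u * m) ?dvdz_mull // -E; ring.
Qed.

(** Classical logic is used because the predicates it serves quantify over frames and come with no
    decision procedure. *)
Lemma ex_least (P : nat -> Prop) : (exists n, P n) ->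
  exists n, P n /\ forall m, P m -> (n <= m)%N.
Proof.
case=> n; elim/ltn_ind: n => n IH Pn.
have [[m [lt_mn Pm]]|Nex] := classic (exists m, (m < n)%N /\ P m).
  exact: IH lt_mn Pm.
exists n; split=> // m Pm; rewrite leqNgt; apply/negP=> lt_mn.
by apply: Nex; exists m.
Qed.

(* For each prime p the lattices of the frames with this [D] form a path in the tree
   of PGL2(Q_p); the frame is an end of each of these paths, and the p-part of [N]
   is p^k for a path with k edges. *)
Record extremal q (D : int) (N : nat) a b c : Prop := Extremal {
  ext_D_gt0 : 0 < D;
  ext_D_dvd : (D %| tqdisc q)%Z;
  ext_N_gt0 : (0 < N)%N;
  ext_frame : frame q D (N%:Z *: a) b c;
  ext_D_min : forall D' a' b' c', 0 < D' -> (D' %| tqdisc q)%Z ->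
    frame q D' a' b' c' -> D <= D';
  ext_N_max : forall (N' : nat) a' b' c', frame q D (N'%:Z *: a') b' c' ->
    (N' <= N)%N }.

Lemma exists_extremal q : isotropic q -> 0 < tqdisc q ->
  exists D N a b c, extremal q D N a b c.
Proof.
move=> /isotropic_frame[a0 [b0 [c0 F0]]] disc_gt0.
pose PD (n : nat) := [/\ (0 < n)%N, (n%:Z %| tqdisc q)%Z
   & exists a b c, frame q n a b c].
have [|D [[D_gt0 D_dvd [a1 [b1 [c1 F1]]]] Dmin]] := @ex_least PD.
  exists `|tqdisc q|%N; have E : `|tqdisc q|%N%:Z = tqdisc q by lia.
  by split; [lia | rewrite E | rewrite E; exists a0, b0, c0].
(* Maximising [N] is minimising [n = D - N]; since [N <= D], truncated subtraction loses nothing. *)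
pose PN (n : nat) := (n <= D)%N /\
  exists a b c, frame q D ((D - n)%N%:Z *: a) b c.
have [|n [[le_nD [a [b [c F]]]] Nmin]] := @ex_least PN.
  exists (D - 1)%N; split; first by lia.
  by exists a1, b1, c1; rewrite subKn // scale1r.
exists D, (D - n)%N, a, b, c.
have N_max (N' : nat) a' b' c' : frame q D (N'%:Z *: a') b' c' ->
    (N' <= D - n)%N.
  (* [D = polar q (N' a') c'] is a multiple of [N']. *)
  move=> F'; have le_N'D : (N' <= D)%N.
    apply: dvdn_leq => //; case: F' => _ _ _ [_ _]; rewrite polarZl => E.
    by have : (N' %| D%:Z)%Z by rewrite -E dvdz_mulr.
  have /Nmin : PN (D - N')%N; last by lia.
  by split; [lia | rewrite subKn //; exists a', b', c'].
split=> //.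
- by have := N_max 1%N a1 b1 c1; rewrite scale1r; apply.
- move=> D' a' b' c' D'_gt0 D'_dvd F'.
  have E : `|D'|%N%:Z = D' by lia.
  have /Dmin : PD `|D'|%N; last by lia.
  by split; [lia | rewrite E | rewrite E; exists a', b', c'].
Qed.

Definition phi a b c (X Y : int) : 'cV[int]_3 :=
  X ^+ 2 *: a + (X * Y) *: b + Y ^+ 2 *: c.

(** [phi(u, 1)] is the third column of the frame sheared by [u]. A factor [p] of it could be moved
    to the first column, against the maximality of [N]. *)
Lemma extremal_upper q D N a b c (p : nat) (u : int) :
  extremal q D N a b c -> prime p ->
  ~ dvdv p (phi (N%:Z *: a) b c u 1).
Proof.
move=> E pp /dvdvP[w phiE].
have := frame_upper u (ext_frame E).
rewrite (_ : c + _ + _ = p%:Z *: w); last first.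
  by rewrite -phiE /phi mulr1 expr1n scale1r addrC [c + _]addrC addrA.
move/(frame_shift (prime_neq0z pp)); rewrite scalerA -PoszM => /(ext_N_max E).
by have := ext_N_gt0 E; have := prime_gt1 pp; nia.
Qed.

(** Once a factor [p] of [N] is moved to the third column, both isotropic columns are divisible by
    [p]. If [b] were too, dividing the frame by [p] would replace [D] by the smaller [D / p ^ 2]. *)
Lemma extremal_middle q D N a b c (p : nat) :
  extremal q D N a b c -> prime p -> (p ^ 2 %| N)%N -> ~ dvdv p b.
Proof.
move=> E pp /dvdnP[k Nk] /dvdvP[b' bE].
have p0 := prime_neq0z pp.
have := frame_swap (ext_frame E).
rewrite (_ : N%:Z *: a = p%:Z *: (p%:Z *: (k%:Z *: a))); last first.
  by rewrite !scalerA Nk; congr (_ *: _); lia.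
move/(frame_shift p0)/frame_swap; rewrite opprK bE => /(frame_divide p0).
case=> D' DE F'; have D_gt0 := ext_D_gt0 E.
have p_gt1 := prime_gt1 pp.
have p2_gt0 : 0 < p%:Z ^+ 2 by rewrite exprn_gt0 //; lia.
have D'_gt0 : 0 < D' by rewrite DE pmulr_rgt0 in D_gt0.
have : D <= D'.
  apply: (ext_D_min E) F' => //; apply: dvdz_trans (ext_D_dvd E).
  by rewrite DE dvdz_mull.
have : 4 <= p%:Z ^+ 2 by rewrite (_ : 4 = 2 ^+ 2) // lerXn2r ?nnegrE; lia.
by rewrite DE; nia.
Qed.

(** [phi(1, w)] is the first column of the frame sheared by [w]. For a suitable [w] the assumed
    divisibility would make it a multiple of [p N], against the maximality of [N]. *)
Lemma extremal_lower q D N a b c (p : nat) (X Y : int) :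
  extremal q D N a b c -> prime p -> ~~ (p %| X)%Z ->
  ~ dvdv (p ^ (logn p N).+1)%N (phi (N%:Z *: a) b c X Y).
Proof.
move=> E pp pX pphi; have N_gt0 := ext_N_gt0 E.
have [N' pN' NE] := pfactor_coprime pp N_gt0.
set P := (p ^ (logn p N).+1)%N in pphi.
have cPN' : coprimez P N' by rewrite coprimezE coprimeXl.
have cPX : coprimez P X.
  by rewrite coprimezE coprimeXl //; have := coprime_primez X pp; rewrite pX.
have [t tP] : exists t, (P %| t * (X * N'%:Z) - 1)%Z.
  by apply: inverse_modz; rewrite coprimezMr cPX.
(* [w] is congruent to [Y / X] modulo [P], so that [phi(1, w)] keeps the divisibility by [P], and is
   a multiple of [N'], so that it also keeps the part of [N] prime to [p]. *)
pose w := t * N'%:Z * Y.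
have Pw : (P %| X * w - Y)%Z.
  by rewrite (_ : _ - _ = Y * (t * (X * N'%:Z) - 1)) ?dvdz_mull // /w; ring.
have Pphi1 : dvdv P (phi (N%:Z *: a) b c 1 w).
  apply: (@dvdv_Gauss _ (X ^+ 2)); first exact: coprimezXr.
  rewrite (_ : _ *: _ = phi (N%:Z *: a) b c X Y + ((X * w - Y) * X) *: b
     + ((X * w - Y) * (X * w + Y)) *: c); last first.
    by apply/matrixP=> i j; rewrite /phi !mxE; ring.
  by apply: dvdvD; first apply: dvdvD => //; apply: dvdvZl; rewrite dvdz_mulr.
have N'phi1 : dvdv N' (phi (N%:Z *: a) b c 1 w).
  rewrite /phi expr1n scale1r mul1r {1}NE PoszM -scalerA /w expr2.
  apply: dvdvD; first apply: dvdvD; apply: dvdvZl; rewrite -?mulrA.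
  - exact: dvdzz.
  - by rewrite dvdz_mull // dvdz_mulr.
  - by rewrite dvdz_mull // dvdz_mulr.
have /dvdvP[a' phiE] : dvdv (p * N)%N (phi (N%:Z *: a) b c 1 w).
  rewrite (_ : (p * N)%N = (P * N')%N); last by rewrite {1}NE /P expnS; lia.
  move=> i; rewrite PoszM Gauss_dvdz //.
  by rewrite Pphi1 N'phi1.
have := frame_lower w (ext_frame E).
rewrite (_ : _ + _ + _ = (p * N)%N%:Z *: a'); last first.
  by rewrite -phiE /phi mul1r expr1n scale1r.
by move/(ext_N_max E); have := prime_gt1 pp; nia.
Qed.

Lemma phi_content_dvd (N : nat) a b c X Y :
  dvdv (gcdz N Y) (phi (N%:Z *: a) b c X Y).
Proof.
rewrite /phi scalerA; apply: dvdvD; first apply: dvdvD; apply: dvdvZl.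
- by rewrite dvdz_mull // dvdz_gcdl.
- by rewrite dvdz_mull // dvdz_gcdr.
- by rewrite expr2 dvdz_mull // dvdz_gcdr.
Qed.

(** With [phi_content_dvd] this makes the content of [phi(X, Y)] exactly [gcd(N, Y)]. Each case of
    the proof contradicts one of the three properties of extremal frames above. *)
Lemma phi_content_max q D N a b c X Y (p : nat) : extremal q D N a b c ->
  coprimez X Y -> prime p ->
  ~ dvdv (p%:Z * gcdz N Y) (phi (N%:Z *: a) b c X Y).
Proof.
move=> E cXY pp; set h := gcdz N Y => phphi.
have pphi : dvdv p (phi (N%:Z *: a) b c X Y).
  by apply: dvdv_trans phphi; rewrite dvdz_mulr.
(* If [p] does not divide [Y], then [(X, Y)] is proportional modulo [p] to [(u, 1)] with
   [u = X / Y]. *)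
have [pY|pY] := boolP (p %| Y)%Z; last first.
  have cpY : coprimez p Y by rewrite coprime_primez.
  have [t tY] := inverse_modz cpY.
  apply: (@extremal_upper q D N a b c p (t * X) E pp).
  apply: (@dvdv_Gauss _ (Y ^+ 2)); first exact: coprimezXr.
  rewrite (_ : _ *: _ = phi (N%:Z *: a) b c X Y
     + ((t * Y - 1) * (t * Y + 1) * X ^+ 2) *: (N%:Z *: a)
     + ((t * Y - 1) * X * Y) *: b); last first.
    by apply/matrixP=> i j; rewrite /phi !mxE; ring.
  by apply: dvdvD; first apply: dvdvD => //; apply: dvdvZl; rewrite -!mulrA dvdz_mulr.
have pX : ~~ (p %| X)%Z.
  apply/negP=> pX; have : (p %| gcdz X Y)%Z by rewrite dvdz_gcd pX.
  rewrite (eqP cXY) dvdz1 /= => /eqP p1; by rewrite p1 in pp.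
have h0 : h != 0 by rewrite gcdz_eq0 negb_and; have := ext_N_gt0 E; lia.
(* If [p h] divides [N], then [p ^ 2] divides [N] and [p] does not divide [Y' = Y / h]. Modulo [p h]
   only the term [X h Y' b] of [phi] survives, so [p] divides [b]. *)
have [phN|phN] := boolP (p%:Z * h %| N%:Z)%Z.
  have pN : (p %| N%:Z)%Z by apply: dvdz_trans phN; rewrite dvdz_mulr.
  have ph : (p %| h)%Z by rewrite dvdz_gcd pN.
  have p2N : (p ^ 2 %| N)%N.
    have : (p%:Z * p%:Z %| N%:Z)%Z by apply: dvdz_trans phN; rewrite dvdz_mul.
    by rewrite dvdzE abszM.
  apply: (extremal_middle E pp p2N).
  have /dvdzP[Y' YE] : (h %| Y)%Z by apply: dvdz_gcdr.
  have pY' : ~~ (p %| Y')%Z.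
    apply/negP=> pY'; have : (p%:Z * h %| h)%Z.
      by rewrite {1}/h dvdz_gcd phN YE /=; apply: dvdz_mul.
    rewrite -{1}[h]mul1r dvdz_mul2r // dvdz1 /= => /eqP p1.
    by rewrite p1 in pp.
  apply: (@dvdv_Gauss _ (X * Y')).
    by rewrite coprime_primez // dvdz_primeM // negb_or pX.
  move=> i; rewrite -(@dvdz_mul2l h) //.
  suff : dvdv (h * p) (h *: ((X * Y') *: b)) by move/(_ i); rewrite mxE.
  rewrite (_ : h *: _ = phi (N%:Z *: a) b c X Y + (- X ^+ 2 * N%:Z) *: a
     + (- (h * h) * Y' ^+ 2) *: c); last first.
    by apply/matrixP=> k j; rewrite /phi !mxE YE; ring.
  rewrite mulrC; apply: dvdvD; first apply: dvdvD => //; apply: dvdvZl.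
    by rewrite dvdz_mull.
  by rewrite dvdz_mulr // dvdzE abszN -dvdzE dvdz_mul.
(* Otherwise [h] contains the full power of [p] in [N], and [p h] is divisible by the next power. *)
apply: (@extremal_lower q D N a b c p X Y E pp pX).
apply: dvdv_trans phphi; rewrite expnS PoszM dvdz_mul //.
have /dvdzP[m NE] : (h %| N%:Z)%Z by apply: dvdz_gcdl.
have pm : ~~ (p %| m)%Z.
  apply: contra phN => /dvdzP[m' mE].
  by rewrite NE mE -mulrA dvdz_mull.
rewrite -(@Gauss_dvdzr _ m); last first.
  by rewrite coprimezE coprimeXl //; have := coprime_primez m pp; rewrite pm.
by rewrite -NE; rewrite dvdzE /= pfactor_dvdnn.
Qed.

(** * Primitive zeros and lattices *)

Lemma scalevI (s : int) : s != 0 -> injective ( *:%R s : 'cV[int]_3 -> _).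
Proof.
move=> s0 x y /matrixP E; apply/matrixP=> i j.
by have := E i j; rewrite !mxE => /(mulfI s0).
Qed.

Lemma content3 x : \big[gcdn/0%N]_(i < 3) absz (x i 0) =
  gcdn (absz (x 0 0)) (gcdn (absz (x 1 0)) (absz (x 2 0))).
Proof.
rewrite !big_ord_recl big_ord0 gcdn0.
by congr (gcdn _ (gcdn (absz (x _ _)) (absz (x _ _)))); apply: val_inj.
Qed.

Lemma vprimitiveP x : vprimitive x <-> forall p : nat, prime p -> ~ dvdv p x.
Proof.
rewrite /vprimitive content3; set g := gcdn _ _.
have dvdg (p : nat) : dvdv p x <-> (p %| g)%N.
  rewrite /g !dvdn_gcd; split=> [px|/and3P[p0 p1 p2]].
    by apply/and3P; split; apply: px.
  exact: ord3P.
split=> [g1 p pp /dvdg|Np]; first by rewrite g1 dvdn1 => /eqP p1; rewrite p1 in pp.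
apply/eqP/negPn/negP=> g1.
have [g0|g0] := posnP g; first by apply: (Np 2%N) => //; apply/dvdg; rewrite g0.
have pg : prime (pdiv g) by apply: pdiv_prime; lia.
by apply: (Np _ pg); apply/dvdg; apply: pdiv_dvd.
Qed.

(** Comparing contents gives [|s| = |t|]. *)
Lemma primitive_parallel x y (s t : int) : vprimitive x -> vprimitive y ->
  s != 0 -> s *: x = t *: y -> x = y \/ x = - y.
Proof.
rewrite /vprimitive !content3 => px py s0 E.
have cZ (r : int) (z : 'cV[int]_3) :
    gcdn (absz ((r *: z) 0 0)) (gcdn (absz ((r *: z) 1 0)) (absz ((r *: z) 2 0)))
    = muln (absz r) (gcdn (absz (z 0 0)) (gcdn (absz (z 1 0)) (absz (z 2 0)))).
  by rewrite !mxE !abszM -!muln_gcdr.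
have := cZ s x; rewrite E cZ px py !muln1 => st.
have [ts|ts] : t = s \/ t = - s by lia.
  by left; apply: (scalevI s0); rewrite E ts.
by right; apply: (scalevI s0); rewrite E ts scaleNr scalerN.
Qed.

Definition vec3 (u v w : int) : 'cV[int]_3 :=
  \col_i (if i == 0 then u else if i == 1 then v else w).

Lemma phi_mx3 a b c X Y :
  phi a b c X Y = mx3 a b c *m vec3 (X ^+ 2) (X * Y) (Y ^+ 2).
Proof. by rewrite mul_mx3 !mxE. Qed.

Lemma frame_phi q D a b c X Y : frame q D a b c ->
  tqeval q (phi a b c X Y) = 0.
Proof. by move=> F; rewrite phi_mx3 (frame_eval _ F) !mxE /=; ring. Qed.

Lemma frame_det_neq0 q D a b c : 0 < D -> frame q D a b c ->
  \det (mx3 a b c) != 0.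
Proof.
move=> D0 /frame_disc E; apply: contraTneq D0 => d0.
by move: E; rewrite d0 expr0n mulr0 => /esym/eqP; rewrite expf_eq0 => /eqP->.
Qed.

Lemma mulmx_inj (M : 'M[int]_3) x y : \det M != 0 -> M *m x = M *m y -> x = y.
Proof.
move=> d0 /(congr1 (mulmx (\adj M))); rewrite !mulmxA mul_adj_mx !mul_scalar_mx.
exact: scalevI.
Qed.

(** In a frame the coordinates of a zero satisfy [y0 y2 = y1 ^ 2], which makes them proportional to
    [(X ^ 2, X Y, Y ^ 2)]. The adjugate keeps them integral, with [det M] times [x] in place of
    [x]. *)
Lemma frame_zero q D a b c x : 0 < D -> frame q D a b c -> tqeval q x = 0 ->
  x != 0 -> exists X Y s t, [/\ coprimez X Y, s != 0 & s *: x = t *: phi a b c X Y].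
Proof.
move=> D0 F qx x0; have d0 := frame_det_neq0 D0 F.
set M := mx3 a b c in d0; pose y := \adj M *m x.
have My : M *m y = \det M *: x by rewrite mulmxA mul_mx_adj mul_scalar_mx.
have := frame_eval y F; rewrite -/M My tqevalZ qx mulr0 => /esym/eqP.
rewrite mulf_eq0 gt_eqF //= subr_eq0 => /eqP yE.
have {}My : \det M *: x = y 0 0 *: a + y 1 0 *: b + y 2 0 *: c.
  by rewrite -My mul_mx3.
have [y0|y0] := eqVneq (y 0 0) 0.
  exists 0, 1, (\det M), (y 2 0); split=> //.
  move: yE; rewrite y0 mul0r => /esym/eqP; rewrite sqrf_eq0 => /eqP y1.
  by rewrite My y0 y1 /phi expr0n mul0r !scale0r !add0r expr1n scale1r.
(* Multiplied by [y0], the coordinates become [(y0 ^ 2, y0 y1, y1 ^ 2)], which is [g ^ 2] times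
   [(X ^ 2, X Y, Y ^ 2)]. *)
pose g := gcdz (y 0 0) (y 1 0).
have g0 : g != 0 by rewrite gcdz_eq0 negb_and y0.
have /dvdzP[X XE] : (g %| y 0%R 0%R)%Z by apply: dvdz_gcdl.
have /dvdzP[Y YE] : (g %| y 1%R 0%R)%Z by apply: dvdz_gcdr.
exists X, Y, (y 0 0 * \det M), (g ^+ 2); split.
- have : gcdz (X * g) (Y * g) = g by rewrite -XE -YE.
  rewrite -mulz_gcdl => E; apply/eqP.
  have gg : `|g| = g by apply/normr_idP.
  by apply: (mulIf g0); rewrite mul1r -{2}E abszE gg.
- by rewrite mulf_neq0.
- rewrite -scalerA My /phi !scalerDr !scalerA yE XE YE.
  by congr (_ *: _ + _ *: _ + _ *: _); ring.
Qed.

Definition lattice_mx (N h : nat) a b c : 'M[int]_3 :=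
  mx3 ((N %/ h)%N%:Z *: a) b (h%:Z *: c).

(** With [Y = h Y'] the coordinates of [phi / h] in the lattice are [(X ^ 2, X Y', Y' ^ 2)], and
    [phi_content_max] makes [phi / h] primitive. *)
Lemma phi_lattice q D N a b c X Y : extremal q D N a b c -> coprimez X Y ->
  let h := gcdn N `|Y| in
  exists w, [/\ phi (N%:Z *: a) b c X Y = h%:Z *: w, primitive_zero q w
              & in_lattice (lattice_mx N h a b c) w].
Proof.
move=> E cXY h; have F := ext_frame E.
have N_gt0 := ext_N_gt0 E.
have h_gt0 : (0 < h)%N by rewrite gcdn_gt0 N_gt0.
have h0 : h%:Z != 0 by lia.
have /dvdvP[w wE] : dvdv h (phi (N%:Z *: a) b c X Y) := phi_content_dvd N a b c X Y.
exists w; split=> //.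
  split.
    apply/vprimitiveP=> p pp /dvdvP[w' w'E].
    apply: (phi_content_max E cXY pp).
    by apply/dvdvP; exists w'; rewrite wE w'E scalerA mulrC.
  have := frame_phi X Y F; rewrite wE tqevalZ => /eqP.
  by rewrite mulf_eq0 sqrf_eq0 (negPf h0) => /eqP.
have /dvdzP[Y' YE] : (h %| Y)%Z by rewrite dvdzE dvdn_gcdr.
exists (vec3 (X ^+ 2) (X * Y') (Y' ^+ 2)).
apply: (scalevI h0); rewrite -wE /phi mul_mx3 !mxE /= !scalerDr !scalerA.
have NE : N%:Z = (N %/ h)%N%:Z * h%:Z by rewrite -PoszM divnK // dvdn_gcdl.
by congr (_ *: _ + _ *: _ + _ *: _); rewrite ?YE ?{1}NE; ring.
Qed.

(** [phi(1, h) / h] is such a zero, because [gcd(N, h) = h]. *)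
Lemma lattice_meets q D N a b c (h : nat) : extremal q D N a b c -> (h %| N)%N ->
  exists x, primitive_zero q x /\ in_lattice (lattice_mx N h a b c) x.
Proof.
move=> E hN; have [] := @phi_lattice q D N a b c 1 h E; first by rewrite coprimezE coprime1n.
by rewrite /= (gcdn_idPr hN) => w [_ zw lw]; exists w.
Qed.

Lemma in_latticeN M x : in_lattice M (- x) <-> in_lattice M x.
Proof.
by split=> [][y yE]; exists (- y); rewrite mulmxN -yE ?opprK.
Qed.

(** Let [h = gcd(N, Y)]. The first coordinates give [h | h'], as [h] is prime to [X]; write
    [h' = s h] and [|Y| = m h]. The last coordinates give [s | m ^ 2], while [s] and [m] are coprime
    because [h gcd(s, m)] divides both [N] and [Y]. Hence [s = 1]. *)
Lemma in_lattice_gcd q D N a b c X Y w (h' : nat) : extremal q D N a b c ->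
  coprimez X Y -> phi (N%:Z *: a) b c X Y = (gcdn N `|Y|)%:Z *: w ->
  (h' %| N)%N -> in_lattice (lattice_mx N h' a b c) w -> h' = gcdn N `|Y|.
Proof.
move=> E cXY; set h := gcdn _ _ => wE h'N [z zE].
have N_gt0 := ext_N_gt0 E.
have h_gt0 : (0 < h)%N by rewrite gcdn_gt0 N_gt0.
have h'_gt0 : (0 < h')%N := dvdn_gt0 N_gt0 h'N.
have NE : N%:Z = (N %/ h')%N%:Z * h'%:Z by rewrite -PoszM divnK.
have d0 := frame_det_neq0 (ext_D_gt0 E) (ext_frame E).
have : h'%:Z *: phi (N%:Z *: a) b c X Y = mx3 (N%:Z *: a) b c *m
    vec3 (h%:Z * z 0 0) (h'%:Z * h%:Z * z 1 0) (h'%:Z * h%:Z * h'%:Z * z 2 0).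
  rewrite wE zE !mul_mx3 !mxE /= !scalerDr !scalerA.
  by congr (_ *: _ + _ *: _ + _ *: _); rewrite ?NE; ring.
rewrite phi_mx3 scalemxAr => /(mulmx_inj d0) vE.
have := congr1 (fun v : 'cV[int]_3 => v 0 0) vE.
have := congr1 (fun v : 'cV[int]_3 => v 2 0) vE.
rewrite !mxE /= => E2 E0.
have hh' : (h %| h')%N.
  have : (h%:Z %| h'%:Z * X ^+ 2)%Z by rewrite E0 dvdz_mulr.
  rewrite Gauss_dvdzl //; apply: coprimezXr.
  rewrite coprimezE; apply: (@coprime_dvdl _ `|Y|); first exact: dvdn_gcdr.
  by rewrite coprime_sym.
have [s sE] := dvdnP hh'.
have [m mE] : exists m, `|Y|%N = (m * h)%N by apply/dvdnP; apply: dvdn_gcdr.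
have m2 : (m ^ 2 = s * `|z 2%R 0%R|)%N.
  have := congr1 absz E2; rewrite !abszM mE sE /= => E3.
  apply/eqP; rewrite -(@eqn_pmul2l (s * h * h ^ 2)); last first.
    by rewrite muln_gt0 -sE h'_gt0 expn_gt0 h_gt0.
  have -> : (s * h * h ^ 2 * m ^ 2 = s * h * (m * h * (m * h)))%N by ring.
  by rewrite E3; apply/eqP; ring.
have cs : coprime s m.
  have : (h * gcdn s m %| h)%N.
    rewrite muln_gcdr {3}/h dvdn_gcd; apply/andP; split.
      by apply: dvdn_trans h'N; rewrite mulnC -sE dvdn_gcdl.
    by rewrite mE [(m * h)%N]mulnC dvdn_gcdr.
  by rewrite -{2}[h]muln1 dvdn_pmul2l // dvdn1.
have : (s %| m ^ 2)%N by rewrite m2 dvdn_mulr.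
rewrite -[(m ^ 2)%N]mul1n Gauss_dvdl ?coprimeXr // dvdn1 => /eqP s1.
by rewrite sE s1 mul1n.
Qed.

Lemma vprimitive_neq0 x : vprimitive x -> x != 0.
Proof.
by move/vprimitiveP=> px; apply/eqP=> x0; apply: (px 2%N) => // i; rewrite x0 mxE.
Qed.

Lemma lattice_unique q D N a b c x : extremal q D N a b c -> primitive_zero q x ->
  exists h : nat, [/\ (h %| N)%N, in_lattice (lattice_mx N h a b c) x &
    forall h' : nat, (h' %| N)%N -> in_lattice (lattice_mx N h' a b c) x -> h' = h].
Proof.
move=> E [px qx].
have [X [Y [s [t [cXY s0 sx]]]]] :=
  frame_zero (ext_D_gt0 E) (ext_frame E) qx (vprimitive_neq0 px).
have [w [wE [pw qw] lw]] := phi_lattice E cXY.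
exists (gcdn N `|Y|); rewrite wE scalerA in sx.
have lxw M : in_lattice M x <-> in_lattice M w.
  by have [->|->] := primitive_parallel px pw s0 sx => //; apply: in_latticeN.
split; [exact: dvdn_gcdl | exact/lxw | move=> h' h'N /lxw].
exact: (in_lattice_gcd E cXY wE h'N).
Qed.

(** * Divisibility relations *)

(** Since [M adj(M) = d], the number [d ^ 2 q(x)] is a value of [q] on the lattice, hence a multiple
    of [D]. Small vectors [x] isolate [d ^ 2] times each coefficient, and these multiples have gcd
    [d ^ 2]. *)
Lemma frame_dvd_det q D a b c : tqprimitive q -> frame q D a b c ->
  (D %| \det (mx3 a b c) ^+ 2)%Z.
Proof.
move=> pq F; set d := \det _.
have Dq x : (D %| d ^+ 2 * tqeval q x)%Z.
  rewrite -tqevalZ -mul_scalar_mx -mul_mx_adj -mulmxA (frame_eval _ F).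
  exact: dvdz_mulr.
have D11 : (D %| d ^+ 2 * q11 q)%Z.
  by have := Dq (vec3 1 0 0); rewrite /tqeval !mxE /= (_ : _ + _ = q11 q) //; ring.
have D22 : (D %| d ^+ 2 * q22 q)%Z.
  by have := Dq (vec3 0 1 0); rewrite /tqeval !mxE /= (_ : _ + _ = q22 q) //; ring.
have D33 : (D %| d ^+ 2 * q33 q)%Z.
  by have := Dq (vec3 0 0 1); rewrite /tqeval !mxE /= (_ : _ + _ = q33 q) //; ring.
have D12 : (D %| d ^+ 2 * q12 q)%Z.
  have := Dq (vec3 1 1 0); rewrite /tqeval !mxE /= => D12.
  rewrite (_ : _ * _ = d ^+ 2 * (q11 q + q12 q + q22 q) - d ^+ 2 * q11 q
    - d ^+ 2 * q22 q); last by ring.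
  rewrite !rpredB //; congr (_ %| _)%Z: D12; ring.
have D13 : (D %| d ^+ 2 * q13 q)%Z.
  have := Dq (vec3 1 0 1); rewrite /tqeval !mxE /= => D13.
  rewrite (_ : _ * _ = d ^+ 2 * (q11 q + q13 q + q33 q) - d ^+ 2 * q11 q
    - d ^+ 2 * q33 q); last by ring.
  rewrite !rpredB //; congr (_ %| _)%Z: D13; ring.
have D23 : (D %| d ^+ 2 * q23 q)%Z.
  have := Dq (vec3 0 1 1); rewrite /tqeval !mxE /= => D23.
  rewrite (_ : _ * _ = d ^+ 2 * (q22 q + q23 q + q33 q) - d ^+ 2 * q22 q
    - d ^+ 2 * q33 q); last by ring.
  rewrite !rpredB //; congr (_ %| _)%Z: D23; ring.
suff : (absz D %| absz (d ^+ 2) * \big[gcdn/0]_(c <- tqcoefs q) absz c)%N.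
  by rewrite pq muln1.
rewrite /tqcoefs !big_cons big_nil gcdn0 !muln_gcdr !dvdn_gcd -!abszM.
by do ?[apply/andP; split].
Qed.

(** Take [f = D / d] and [w = d / f]. Writing [m = s D] gives [s d ^ 2 = D ^ 2], so [d | D] and
    [s = f ^ 2]; then [D | d ^ 2] becomes [f | d]. *)
Lemma disc_factor (m D d : nat) : (0 < d)%N -> (0 < D)%N ->
  (m * d ^ 2 = D ^ 3)%N -> (D %| m)%N -> (D %| d ^ 2)%N ->
  exists f w : nat, [/\ m = (f ^ 4 * w)%N, D = (f ^ 2 * w)%N & d = (f * w)%N].
Proof.
move=> d_gt0 D_gt0 mE /dvdnP[s sE] Dd.
have sd : (s * d ^ 2 = D ^ 2)%N.
  by apply/eqP; rewrite -(eqn_pmul2r D_gt0); apply/eqP; rewrite -expnSr -mE sE; lia.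
have /dvdnP[f fE] : (d %| D)%N by rewrite -(@dvdn_pexp2r _ _ 2) // -sd dvdn_mull.
have sf : s = (f ^ 2)%N.
  have d2_gt0 : (0 < d ^ 2)%N by rewrite expn_gt0 d_gt0.
  by apply/eqP; rewrite -(eqn_pmul2r d2_gt0) sd fE expnMn.
have /dvdnP[w wE] : (f %| d)%N.
  by move: Dd; rewrite fE -mulnn dvdn_pmul2r.
by exists f, w; rewrite sE sf fE wE; split; lia.
Qed.

Lemma powerfree2_disc_factor (f w : nat) : powerfree 2 (f ^ 4 * w) -> f = 1%N.
Proof.
move=> sf; have [f1|f0|//] := ltngtP f 1.
- by have := sf 2%N isT; rewrite (_ : f = 0)%N ?exp0n ?mul0n //; lia.
- have := sf _ (pdiv_prime f0); case/negP.
  by rewrite dvdn_mulr // (expnD f 2 2) dvdn_mulr // dvdn_exp2r // pdiv_dvd.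
Qed.

Lemma squarefree_dvdn (m n : nat) : (0 < m)%N -> powerfree 2 m ->
  (forall p : nat, prime p -> (p %| m)%N -> (p %| n)%N) -> (m %| n)%N.
Proof.
move=> m_gt0 sf mn; apply/dvdn_partP=> // p; rewrite mem_primes => /and3P[pp _ pm].
rewrite p_part (_ : logn p m = 1)%N ?mn //.
have : (logn p m < 2)%N by rewrite ltnNge -pfactor_dvdn // sf.
by have : (0 < logn p m)%N by [rewrite -pfactor_dvdn ?expn1]; lia.
Qed.

(** Modulo [p] the matrix [M] kills a nonzero vector on the conic [y0 y2 = y1 ^ 2]. Depending on
    where this vector lies, extremality is contradicted or [p] divides [N]. *)
Lemma extremal_prime_dvd q D N a b c (p : nat) : extremal q D N a b c ->
  D = tqdisc q -> `|\det (mx3 (N%:Z *: a) b c)|%N = `|tqdisc q|%N ->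
  prime p -> (p %| tqdisc q)%Z -> ~~ (p ^ 2 %| `|tqdisc q|)%N -> (p %| N)%N.
Proof.
move=> E DE; set M := mx3 _ _ _ => dE pp pD p2D.
have D_gt0 := ext_D_gt0 E; have F := ext_frame E.
have d2E : \det M ^+ 2 = D ^+ 2.
  have [->|->] : \det M = D \/ \det M = - D by lia.
    by [].
  by rewrite sqrrN.
have pd : (p %| \det M)%Z by rewrite dvdzE dE -dvdzE.
have p0 := prime_neq0z pp.
(* If [p] divided [adj M], then [p ^ 3] would divide its determinant [det(M) ^ 2], forcing [p ^ 2]
   to divide the discriminant. *)
have [i Ni] : exists i, ~ dvdv p (col i (\adj M)).
  apply: not_all_ex_not => pA.
  have [A AE] : exists A : 'M[int]_3, \adj M = p%:Z *: A.
    exists (\matrix_(i, j) ((\adj M i j %/ p%:Z)%Z)); apply/matrixP=> i j.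
    by rewrite !mxE mulrC divzK //; have := pA j i; rewrite !mxE.
  have := mul_mx_adj M; rewrite AE -scalemxAr => /(congr1 determinant).
  rewrite detZ det_mulmx det_scalar !exprS expr0 mulr1 => /(congr1 absz).
  rewrite !abszM dE /= => detE.
  case/negP: p2D; case/dvdnP: (pD : (p %| `|tqdisc q|)%N) => m mE.
  have m_gt0 : (0 < m)%N.
    have : (0 < `|tqdisc q|)%N by lia.
    by rewrite mE muln_gt0 => /andP[].
  have p_gt0 := prime_gt0 pp.
  have {}detE : (p * `|\det A| = m ^ 2)%N.
    apply/eqP; rewrite -(@eqn_pmul2l (m * p ^ 3)); last first.
      by rewrite muln_gt0 m_gt0 expn_gt0 p_gt0.
    move: detE; rewrite mE => detE.
    have -> : (m * p ^ 3 * (p * `|\det A|) =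
      p * (p * p) * (m * p * `|\det A|))%N by ring.
    by rewrite detE; apply/eqP; ring.
  have : (p %| m ^ 2)%N by rewrite -detE dvdn_mulr.
  by rewrite Euclid_dvdX // => /andP[pm _]; rewrite mE expnS expn1 dvdn_mul.
pose y := col i (\adj M).
have My : M *m y = \det M *: delta_mx i 0.
  by rewrite /y colE mulmxA mul_mx_adj mul_scalar_mx.
have pMy : dvdv p (y 0 0 *: (N%:Z *: a) + y 1 0 *: b + y 2 0 *: c).
  by rewrite -mul_mx3 -/M My; apply: dvdvZl.
(* The value of [q] at [M y] is divisible by [D ^ 2]; after cancelling one factor [D], the other is
   still a multiple of [p]. *)
have pq0 : (p %| y 0%R 0%R * y 2%R 0%R - y 1%R 0%R ^+ 2)%Z.
  have := frame_eval y F; rewrite -/M My tqevalZ d2E expr2 -mulrA.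
  by move/(mulfI (lt0r_neq0 D_gt0)) => <-; rewrite dvdz_mulr // DE.
have {}Ni : ~ [/\ (p %| y 0%R 0%R)%Z, (p %| y 1%R 0%R)%Z & (p %| y 2%R 0%R)%Z].
  by case=> py0 py1 py2; apply: Ni; apply: ord3P.
move: (y 0 0) (y 1 0) (y 2 0) pMy pq0 Ni => y0 y1 y2 pMy pq0 Ni {My y}.
(* If [p] divides [y0], the vector is proportional to [(0, 0, 1)] modulo [p], so [p] divides
   [c = phi(0, 1)]. *)
have [py0|py0] := boolP (p %| y0)%Z.
  have py1 : (p %| y1)%Z.
    have : (p %| y1 * y1)%Z.
      rewrite (_ : y1 * y1 = y0 * y2 - (y0 * y2 - y1 ^+ 2)); last by ring.
      by rewrite rpredB // dvdz_mulr.
    by rewrite dvdz_primeM // orbb.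
  case: (@extremal_upper q D N a b c p 0 E pp).
  rewrite /phi expr0n mul0r !scale0r !add0r expr1n scale1r.
  apply: (@dvdv_Gauss _ y2).
    by rewrite coprime_primez //; apply/negP=> py2; apply: Ni.
  rewrite (_ : y2 *: c = (y0 *: (N%:Z *: a) + y1 *: b + y2 *: c)
    + (- y0) *: (N%:Z *: a) + (- y1) *: b).
    by apply: dvdvD; first apply: dvdvD => //; apply: dvdvZl; rewrite rpredN.
  by apply/matrixP=> k j; rewrite !mxE; ring.
(* If [p] divides [y1] but not [y0], the vector is proportional to [(1, 0, 0)], so [p] divides
   [N a]; by the maximality of [N] it does not divide [a]. *)
have [py1|py1] := boolP (p %| y1)%Z.
  have py2 : (p %| y2)%Z.
    have : (p %| y0 * y2)%Z.
      rewrite (_ : y0 * y2 = y1 * y1 + (y0 * y2 - y1 ^+ 2)); last by ring.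
      by rewrite rpredD // dvdz_mulr.
    by rewrite dvdz_primeM // (negPf py0).
  apply/negPn/negP=> pN.
  have : dvdv p a.
    apply: (@dvdv_Gauss _ N%:Z); first by rewrite coprime_primez.
    apply: (@dvdv_Gauss _ y0); first by rewrite coprime_primez.
    rewrite (_ : y0 *: _ = (y0 *: (N%:Z *: a) + y1 *: b + y2 *: c)
      + (- y1) *: b + (- y2) *: c).
      by apply: dvdvD; first apply: dvdvD => //; apply: dvdvZl; rewrite rpredN.
    by apply/matrixP=> k j; rewrite !mxE; ring.
  case/dvdvP=> a' aE; move: F; rewrite aE scalerA -PoszM => /(ext_N_max E).
  by rewrite -[X in (_ <= X)%N]muln1 leq_pmul2l ?(ext_N_gt0 E) // leqNgt (prime_gt1 pp).
(* Here the vector is proportional to [(u ^ 2, u, 1)] with [u = y0 / y1], so [p] divides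
   [phi(u, 1)]. *)
have cpy1 : coprimez p y1 by rewrite coprime_primez.
have [t tP] := inverse_modz cpy1.
case: (@extremal_upper q D N a b c p (t * y0) E pp).
apply: (@dvdv_Gauss _ (y1 ^+ 2)); first exact: coprimezXr.
rewrite (_ : _ *: _ = y0 *: (y0 *: (N%:Z *: a) + y1 *: b + y2 *: c)
   + ((t * y1 - 1) * ((t * y1 + 1) * y0 ^+ 2)) *: (N%:Z *: a)
   + ((t * y1 - 1) * (y0 * y1)) *: b
   + (- (y0 * y2 - y1 ^+ 2)) *: c).
  apply: dvdvD; last by apply: dvdvZl; rewrite rpredN.
  apply: dvdvD; last by apply: dvdvZl; rewrite dvdz_mulr.
  by apply: dvdvD; [exact: dvdvZr | apply: dvdvZl; rewrite dvdz_mulr].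
by apply/matrixP=> k j; rewrite /phi !mxE; ring.
Qed.

(** Square-freeness makes [f = 1] in [disc_factor], so [D] and [|det M|] equal the discriminant.
    Then [N] divides [D], and every prime factor of [D] divides [N]. *)
Lemma extremal_squarefree q D N a b c : tqprimitive q -> 0 < tqdisc q ->
  extremal q D N a b c -> powerfree 2 `|tqdisc q| -> N = `|tqdisc q|%N.
Proof.
move=> pq disc_gt0 E sf; have F := ext_frame E; have D_gt0 := ext_D_gt0 E.
have d0 := frame_det_neq0 D_gt0 F.
have mE := congr1 absz (frame_disc F).
rewrite abszM !abszX in mE.
have Dd := frame_dvd_det pq F; rewrite dvdzE abszX in Dd.
have [||f [w [discE DE dE]]] := disc_factor _ _ mE (ext_D_dvd E) Dd.
- by rewrite absz_gt0.
- by lia.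
rewrite discE in sf; have f1 := powerfree2_disc_factor sf.
rewrite -discE in sf; rewrite f1 !exp1n !mul1n in discE DE dE.
have DD : D = tqdisc q by lia.
apply/eqP; rewrite eqn_dvd; apply/andP; split.
  have [_ _ _ [_ _]] := F; rewrite polarZl -DD => <-.
  by rewrite abszM dvdn_mulr.
apply: squarefree_dvdn => //; first by lia.
move=> p pp pD; apply: (extremal_prime_dvd E DD _ pp) => //.
  by rewrite dE discE.
exact: sf.
Qed.

(** In the notation of [disc_factor] the quotient of the discriminant by [det M] is [f ^ 3], and
    [f ^ 4] divides the discriminant. *)
Lemma frame_divisibility q D a b c : tqprimitive q -> 0 < tqdisc q -> 0 < D ->
  (D %| tqdisc q)%Z -> frame q D a b c -> 0 < \det (mx3 a b c) ->
  [/\ (\det (mx3 a b c) %| tqdisc q)%Z, (\det (mx3 a b c) %| D)%Z &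
      forall p : nat, prime p ->
        (p%:Z %| (tqdisc q %/ \det (mx3 a b c))%Z)%Z ->
        (4 <= logn p `|tqdisc q|)%N].
Proof.
move=> pq disc_gt0 D_gt0 D_dvd F d_gt0.
have mE := congr1 absz (frame_disc F).
rewrite abszM !abszX in mE.
have Dd := frame_dvd_det pq F; rewrite dvdzE abszX in Dd.
have [||f [w [discE DE dE]]] := disc_factor _ _ mE D_dvd Dd; try lia.
split.
- by rewrite dvdzE discE dE (expnSr f 3) -mulnA dvdn_mull.
- by rewrite dvdzE DE dE expnS expn1 -mulnA dvdn_mull.
move=> p pp; have -> : (tqdisc q %/ \det (mx3 a b c))%Z = (f ^ 3)%N%:Z.
  have -> : tqdisc q = (f ^ 3)%N%:Z * \det (mx3 a b c).
    by rewrite -[LHS]gtz0_abs // -[\det _]gtz0_abs // discE dE -PoszM; congr Posz; ring.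
  by rewrite mulzK // gt_eqF.
rewrite dvdzE /= Euclid_dvdX // => /andP[pf _].
rewrite -pfactor_dvdn //; last by rewrite absz_gt0 gt_eqF.
by rewrite discE dvdn_mulr // dvdn_exp2r.
Qed.

(** * Reduction *)

(** For [u < 0], consider the value [u (u w - v ^ 2)] at [(- v, u)]. *)
Lemma nonpos2_minor (u v w : int) :
  (forall x y : int, u * x ^+ 2 + 2 * v * x * y + w * y ^+ 2 <= 0) ->
  0 <= u * w - v ^+ 2.
Proof.
move=> H; have u0 := H 1 0; have w0 := H 0 1; have uv := H (- v) u.
have [u_eq0|u_neq0] := eqVneq u 0.
  (* Here [w <= 0], and the value at [(v (1 - w), 1)] is [2 v ^ 2 (1 - w) + w], so [v = 0]. *)
  by subst u; have := H (v * (1 - w)) 1; nia.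
have u_lt0 : u < 0 by lia.
rewrite -(nmulr_rle0 _ u_lt0).
by apply: le_trans uv; rewrite le_eqVlt; apply/orP; left; apply/eqP; ring.
Qed.

(** A negative semidefinite form has nonnegative diagonal cofactors. With a positive determinant its
    adjugate would be negative semidefinite too, which kills the diagonal cofactors, then those of
    the first row, and so the determinant. *)
Lemma sym3_positive (g11 g12 g13 g22 g23 g33 : int) :
  0 < g11 * (g22 * g33 - g23 * g23) - g12 * (g12 * g33 - g23 * g13)
      + g13 * (g12 * g23 - g22 * g13) ->
  exists u v w : int, 0 < g11 * u ^+ 2 + g22 * v ^+ 2 + g33 * w ^+ 2
    + 2 * g12 * u * v + 2 * g13 * u * w + 2 * g23 * v * w.
Proof.
set d := (X in 0 < X) => d_gt0; apply: NNPP => Nex.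
have H (u v w : int) : g11 * u ^+ 2 + g22 * v ^+ 2 + g33 * w ^+ 2
    + 2 * g12 * u * v + 2 * g13 * u * w + 2 * g23 * v * w <= 0.
  by rewrite leNgt; apply/negP=> uvw; apply: Nex; exists u, v, w.
pose A11 := g22 * g33 - g23 ^+ 2; pose A12 := g13 * g23 - g12 * g33.
pose A13 := g12 * g23 - g13 * g22; pose A22 := g11 * g33 - g13 ^+ 2.
pose A23 := g12 * g13 - g11 * g23; pose A33 := g11 * g22 - g12 ^+ 2.
have A11_ge0 : 0 <= A11.
  apply: nonpos2_minor => x y; apply: le_trans (H 0 x y).
  by rewrite le_eqVlt; apply/orP; left; apply/eqP; ring.
have A22_ge0 : 0 <= A22.
  apply: nonpos2_minor => x y; apply: le_trans (H x 0 y).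
  by rewrite le_eqVlt; apply/orP; left; apply/eqP; ring.
have A33_ge0 : 0 <= A33.
  apply: nonpos2_minor => x y; apply: le_trans (H x y 0).
  by rewrite le_eqVlt; apply/orP; left; apply/eqP; ring.
(* The value at [adj G w] is [det G] times the value of [adj G] at [w], so the
   adjugate is negative semidefinite as well. *)
have HA (u v w : int) : A11 * u ^+ 2 + A22 * v ^+ 2 + A33 * w ^+ 2
    + 2 * A12 * u * v + 2 * A13 * u * w + 2 * A23 * v * w <= 0.
  rewrite -(pmulr_rle0 _ d_gt0).
  apply: le_trans (H (A11 * u + A12 * v + A13 * w) (A12 * u + A22 * v + A23 * w)
    (A13 * u + A23 * v + A33 * w)).
  rewrite le_eqVlt; apply/orP; left; apply/eqP.
  by rewrite /d /A11 /A12 /A13 /A22 /A23 /A33; ring.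
have A11_0 : A11 = 0 by have := HA 1 0 0; lia.
have A22_0 : A22 = 0 by have := HA 0 1 0; lia.
have A33_0 : A33 = 0 by have := HA 0 0 1; lia.
have sq0 (u : int) : 0 <= 0 * 0 - u ^+ 2 -> u = 0.
  by rewrite mul0r sub0r oppr_ge0 => u2; apply/eqP; rewrite -sqrf_eq0 eq_le u2 sqr_ge0.
have A12_0 : A12 = 0.
  apply: sq0; apply: nonpos2_minor => x y; apply: le_trans (HA x y 0).
  by rewrite A11_0 A22_0 A33_0 le_eqVlt; apply/orP; left; apply/eqP; ring.
have A13_0 : A13 = 0.
  apply: sq0; apply: nonpos2_minor => x y; apply: le_trans (HA x 0 y).
  by rewrite A11_0 A22_0 A33_0 le_eqVlt; apply/orP; left; apply/eqP; ring.
have : d = g11 * A11 + g12 * A12 + g13 * A13 by rewrite /d /A11 /A12 /A13; ring.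
by rewrite A11_0 A12_0 A13_0; lia.
Qed.

Lemma diag_dominant_det3 (B d1 d2 d3 u v w : int) : 0 < B ->
  5 * B <= d1 -> 5 * B <= d2 -> 5 * B <= d3 ->
  `|u| <= 2 * B -> `|v| <= 2 * B -> `|w| <= 2 * B ->
  0 < d1 * (d2 * d3 - w * w) - u * (u * d3 - w * v) + v * (u * w - d2 * v).
Proof.
move=> B0 h1 h2 h3 hu hv hw.
have sq (t : int) : `|t| <= 2 * B -> 0 <= 4 * B ^+ 2 - t ^+ 2.
  move=> ht; rewrite subr_ge0 -[t ^+ 2]real_normK ?num_real //.
  rewrite (_ : 4 * B ^+ 2 = (2 * B) ^+ 2); last by ring.
  by rewrite lerXn2r ?nnegrE //; lia.
have uvw : - (8 * B ^+ 3) <= u * v * w.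
  have : `|u * v * w| <= 2 * B * (2 * B) * (2 * B).
    by rewrite !normrM; do 2?[apply: ler_pM => //]; rewrite ?mulr_ge0.
  rewrite ler_norml => /andP[+ _]; congr (_ <= _); ring.
have [e1 [E1 e1_ge0]] : exists e, d1 = 5 * B + e /\ 0 <= e by exists (d1 - 5 * B); lia.
have [e2 [E2 e2_ge0]] : exists e, d2 = 5 * B + e /\ 0 <= e by exists (d2 - 5 * B); lia.
have [e3 [E3 e3_ge0]] : exists e, d3 = 5 * B + e /\ 0 <= e by exists (d3 - 5 * B); lia.
(* The bounds on the off-diagonal entries use up [60 B ^ 3 + 16 B ^ 3] of the term [125 B ^ 3] of
   [d1 d2 d3]; [49 B ^ 3] remains. *)
have -> : d1 * (d2 * d3 - w * w) - u * (u * d3 - w * v) + v * (u * w - d2 * v)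
  = d1 * (4 * B ^+ 2 - w ^+ 2) + d2 * (4 * B ^+ 2 - v ^+ 2)
    + d3 * (4 * B ^+ 2 - u ^+ 2) + 2 * (u * v * w - - (8 * B ^+ 3))
    + (49 * B ^+ 3 + 21 * B ^+ 2 * (e1 + e2 + e3)
       + 5 * B * (e1 * e2 + e1 * e3 + e2 * e3) + e1 * e2 * e3).
  by rewrite E1 E2 E3; ring.
have B_ge0 := ltW B0.
have d1_ge0 : 0 <= d1 by lia.
have d2_ge0 : 0 <= d2 by lia.
have d3_ge0 : 0 <= d3 by lia.
apply: ltr_wpDl.
  by rewrite !addr_ge0 // mulr_ge0 ?sq // subr_ge0.
have B3 : 0 < 49 * B ^+ 3 by rewrite mulr_gt0 // exprn_gt0.
apply: ltr_pwDl; last by rewrite !mulr_ge0.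
apply: ltr_pwDl; last by rewrite mulr_ge0 ?addr_ge0 ?mulr_ge0.
by apply: ltr_pwDl; rewrite // mulr_ge0 ?addr_ge0 // mulr_ge0 ?exprn_ge0.
Qed.
Lemma positive_vector q (B : int) : 0 < tqdisc q -> 0 < B ->
  (forall i j, `|tqmx q i j| <= B) ->
  exists e, \sum_i (tqmx q *m e) i 0 ^+ 2 < 7 * B * tqeval q e.
Proof.
move=> disc_gt0 B_gt0 hB.
(* The factor 7 leaves diagonal entries at least [5 B] in [C], against off-diagonal entries at most
   [2 B] in absolute value. *)
pose C := (7 * B)%:M - 2 *: tqmx q; pose G := tqmx q *m C.
have Qsym i j : tqmx q i j = tqmx q j i.
  by move: i j; apply: ord3P; apply: ord3P; rewrite !mxE.
have Gsym i j : G i j = G j i.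
  by move: i j; apply: ord3P; apply: ord3P; rewrite !mxE !sum3 !mxE /=; ring.
have dG : 0 < \det G.
  rewrite det_mulmx -tqdiscE mulr_gt0 ?mulr_gt0 // det3.
  have Csym i j : C i j = C j i.
    by move: i j; apply: ord3P; apply: ord3P; rewrite !mxE.
  rewrite (Csym 1 0) (Csym 2 0) (Csym 2 1).
  have hd i : 5 * B <= C i i.
    have -> : C i i = 7 * B - 2 * tqmx q i i.
      by move: i; apply: ord3P; rewrite !mxE /=; ring.
    by have := hB i i; lia.
  have ho i j : i != j -> `|C i j| <= 2 * B.
    move=> ij; have -> : C i j = - (2 * tqmx q i j).
      by rewrite !mxE (negPf ij) mulr0n sub0r.
    by have := hB i j; lia.
  by apply: (@diag_dominant_det3 B); rewrite ?hd ?ho.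
move: dG; rewrite det3 (Gsym 1 0) (Gsym 2 0) (Gsym 2 1).
case/sym3_positive=> u [v [w H]]; exists (vec3 u v w).
(* The value of [G] at [e] is twice [7 B q(e) - |Q e| ^ 2]. *)
rewrite -subr_gt0 -(@pmulr_rgt0 _ 2) //; congr (0 < _): H.
by rewrite !mxE !sum3 !mxE !sum3 !mxE /tqeval !mxE /=; ring.
Qed.

Lemma exists_entry_bound q : 0 < tqdisc q ->
  exists B : int, [/\ 0 < B, forall i j, `|tqmx q i j| <= B &
    B ^+ 2 <= \sum_i \sum_j tqmx q i j ^+ 2].
Proof.
move=> disc_gt0.
pose F (k : 'I_3 * 'I_3) : nat := `|tqmx q k.1 k.2|%N.
have [k _ kmax] := @arg_maxnP _ (0 : 'I_3, 0 : 'I_3) xpredT F isT.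
exists (F k)%:Z; have hB i j : `|tqmx q i j| <= (F k)%:Z.
  by rewrite -abszE lez_nat; apply: (kmax (i, j)).
split=> //.
  rewrite lt_neqAle lez_nat leq0n andbT eq_sym; apply/eqP=> Fk0.
  have Q0 : tqmx q = 0.
    apply/matrixP=> i j; rewrite [RHS]mxE; apply/eqP; rewrite -normr_eq0 eq_le.
    by rewrite -{1}Fk0 hB normr_ge0.
  by have := tqdiscE q; rewrite Q0 det0; lia.
have -> : (F k)%:Z ^+ 2 = tqmx q k.1 k.2 ^+ 2.
  by rewrite /F abszE real_normK // num_real.
rewrite (bigD1 k.1) //= (bigD1 k.2) //= -addrA lerDl addr_ge0 //.
  by apply: sumr_ge0 => i _; apply: sqr_ge0.
by apply: sumr_ge0 => i _; apply: sumr_ge0 => j _; apply: sqr_ge0.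
Qed.

(** The polar form pairs [a] with [c] and takes the value [- 2 D] at [(b, b)], so pairing [x] with
    the columns reads off its coordinates; the factor [2 D] keeps them integral. *)
Lemma frame_expand q D a b c x : 0 < D -> frame q D a b c ->
  (2 * D) *: x = (2 * polar q c x) *: a - polar q b x *: b + (2 * polar q a x) *: c.
Proof.
move=> D0 F; have d0 := frame_det_neq0 D0 F.
set M := mx3 a b c in d0.
have [y My] : exists y, \det M *: x = y 0 0 *: a + y 1 0 *: b + y 2 0 *: c.
  by exists (\adj M *m x); rewrite -mul_mx3 mulmxA mul_mx_adj mul_scalar_mx.
case: F => qa qc qb [ab bc ac].
have [ba [cb ca]] : polar q b a = 0 /\ polar q c b = 0 /\ polar q c a = D.
  by rewrite !(polarC _ _ a) (polarC _ c b).
have cx : \det M * polar q c x = D * y 0 0.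
  by rewrite -polarZr My !polarE qc ca cb; ring.
have bx : \det M * polar q b x = - (2 * D) * y 1 0.
  by rewrite -polarZr My !polarE qb ba bc; ring.
have ax : \det M * polar q a x = D * y 2 0.
  by rewrite -polarZr My !polarE qa ab ac; ring.
apply: (scalevI d0).
rewrite [LHS]scalerA [\det M * _]mulrC -[LHS]scalerA My.
rewrite !scalerDr !scalerN !scalerA -scaleNr !(mulrCA _ 2) cx bx ax.
by congr (_ *: _ + _ *: _ + _ *: _); ring.
Qed.

Lemma frame_polar q D a b c x y : 0 < D -> frame q D a b c ->
  2 * D * polar q x y = 2 * (polar q c x * polar q a y + polar q a x * polar q c y)
    - polar q b x * polar q b y.
Proof.
move=> D0 F; rewrite -[LHS]polarZl (frame_expand x D0 F) -scaleNr !polarE; ring.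
Qed.

Lemma in_lattice_upper a b c (u : int) x :
  in_lattice (mx3 a (b + (2 * u) *: a) (c + u *: b + u ^+ 2 *: a)) x <->
  in_lattice (mx3 a b c) x.
Proof.
split=> [][y ->].
  exists (vec3 (y 0 0 + 2 * u * y 1 0 + u ^+ 2 * y 2 0) (y 1 0 + u * y 2 0) (y 2 0)).
  by rewrite !mul_mx3; apply/matrixP=> i j; rewrite !mxE /=; ring.
exists (vec3 (y 0 0 - 2 * u * y 1 0 + u ^+ 2 * y 2 0) (y 1 0 - u * y 2 0) (y 2 0)).
by rewrite !mul_mx3; apply/matrixP=> i j; rewrite !mxE /=; ring.
Qed.

Lemma in_lattice_swap a b c x :
  in_lattice (mx3 c (- b) a) x <-> in_lattice (mx3 a b c) x.
Proof.
split=> [][y ->]; exists (vec3 (y 2 0) (- y 1 0) (y 0 0));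
by rewrite !mul_mx3; apply/matrixP=> i j; rewrite !mxE /=; ring.
Qed.

Lemma in_lattice_opp a b c x :
  in_lattice (mx3 (- a) (- b) (- c)) x <-> in_lattice (mx3 a b c) x.
Proof.
split=> [][y ->]; exists (- y);
by rewrite !mul_mx3; apply/matrixP=> i j; rewrite !mxE /=; ring.
Qed.

(** The binary form with coefficients [polar q a e], [polar q b e], [polar q c e] is definite,
    because [frame_polar] gives it the discriminant [- 4 D q(e)]. A frame minimising the sum of the
    absolute values of the outer coefficients is reduced. *)
Lemma reduced_frame q (D : int) a b c e : 0 < D -> frame q D a b c -> 0 < tqeval q e ->
  exists a' b' c', [/\ frame q D a' b' c',
    forall x, in_lattice (mx3 a' b' c') x <-> in_lattice (mx3 a b c) x &
    polar q b' e ^+ 2 <= polar q a' e * polar q c' e].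
Proof.
move=> D0 F0 qe.
pose P (n : nat) := exists a' b' c', [/\ frame q D a' b' c',
    forall x, in_lattice (mx3 a' b' c') x <-> in_lattice (mx3 a b c) x &
    (n = `|polar q a' e| + `|polar q c' e|)%N].
have [|n [[a1 [b1 [c1 [F L nE]]]] nmin]] := @ex_least P.
  by eexists; exists a, b, c; split.
exists a1, b1, c1; split=> //.
have pos := frame_polar e e D0 F; rewrite polarxx in pos.
have up (u : int) : (n <= absz (polar q a1 e) +
    absz (polar q c1 e + u * polar q b1 e + u ^+ 2 * polar q a1 e)%R)%N.
  apply: nmin; exists a1; do 2!eexists; split; first exact: (frame_upper u F).
    by move=> x; rewrite in_lattice_upper L.
  by rewrite !polarE.
have lo (u : int) : (n <= absz (polar q a1 e + u * polar q b1 e + u ^+ 2 * polar q c1 e)%R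
    + absz (polar q c1 e))%N.
  (* A lower shear is an upper shear conjugated by the swap, so [in_lattice_upper] covers it as
     well. *)
  have Fs := frame_upper (- u) (frame_swap F).
  apply: nmin; do 3!eexists; split; first exact: (frame_swap Fs).
    by move=> x; rewrite in_lattice_swap in_lattice_upper in_lattice_swap L.
  rewrite -!scaleN1r !polarE; congr (absz _ + _)%N; ring.
have up1 := up 1; have up2 := up (-1); have lo1 := lo 1; have lo2 := lo (-1).
move: pos up1 up2 lo1 lo2; rewrite {}nE {up lo nmin L F F0}.
move: (polar q a1 e) (polar q b1 e) (polar q c1 e) (tqeval q e) qe.
move=> z3 z2 z1 E E0.
rewrite (_ : (-1) ^+ 2 = 1 :> int) // !expr1n !mul1r !mulN1r => pos up1 up2 lo1 lo2.
have DE : 0 < D * E by rewrite mulr_gt0.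
have disc_pos : z2 ^+ 2 < 4 * (z3 * z1).
  by rewrite -subr_gt0; congr (0 < _): (mulr_gt0 (isT : 0 < 4 :> int) DE); lia.
have z13 : 0 < z3 * z1 by have := sqr_ge0 z2; lia.
have sumsq : z2 ^+ 2 < (z1 + z3) ^+ 2.
  apply: lt_le_trans disc_pos _; rewrite -subr_ge0.
  by rewrite (_ : _ - _ = (z1 - z3) ^+ 2) ?sqr_ge0 //; ring.
(* This fixes the signs of [z1 + z3 + z2] and [z1 + z3 - z2], which removes the absolute values from
   the four minimality inequalities. *)
have lt_sum : `|z2| < `|z1 + z3|.
  by rewrite -(@ltr_pXn2r _ 2) ?nnegrE // !real_normK ?num_real.
have [[z1p z3p]|[z1n z3n]] : (0 < z1 /\ 0 < z3) \/ (z1 < 0 /\ z3 < 0) by nia.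
- have h1 : `|z2| <= z1 by lia.
  have h3 : `|z2| <= z3 by lia.
  by rewrite -[z2 ^+ 2]real_normK ?num_real // expr2 ler_pM.
- have h1 : `|z2| <= - z1 by lia.
  have h3 : `|z2| <= - z3 by lia.
  by rewrite -[z2 ^+ 2]real_normK ?num_real // expr2 -[z3 * z1]mulrNN ler_pM.
Qed.

(** With [z1, z2, z3] and [s1, s2, s3] the pairings of the columns [c, b, a] with [e] and with [x],
    [P] is [8 D ^ 2] times the majorant [polar q x e ^ 2 - q(e) polar q x x], positive definite for
    [q(e) > 0] as [q] has signature (1, 2). The weighted sums of squares [E1] and [E2] give the
    bounds. *)
Lemma reduced_majorant (z1 z2 z3 s1 s2 s3 : int) :
  0 < z1 * z3 -> z2 ^+ 2 <= z1 * z3 ->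
  let d := 4 * (z1 * z3) - z2 ^+ 2 in
  let P := 2 * (2 * z3 * s1 + 2 * z1 * s3 - z2 * s2) ^+ 2
           - d * (4 * (s1 * s3) - s2 ^+ 2) in
  3 * d * s2 ^+ 2 <= 5 * P /\
  6 * d * (z3 ^+ 2 * s1 ^+ 2 + z1 ^+ 2 * s3 ^+ 2) <= 5 * (z1 * z3) * P.
Proof.
move=> p_gt0 zz d P; set p := z1 * z3; set m := z2 ^+ 2.
have m_ge0 : 0 <= m := sqr_ge0 z2.
have d_gt0 : 0 < d by rewrite /d -/p -/m; lia.
have pm_gt0 : 0 < 4 * p + m by lia.
have pm_ge0 : 0 <= 4 * p - m by lia.
(* Reduction, that is [m <= p], gives [(4 p + m) / (4 p - m) <= 5 / 3], the origin of the constants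
   in the conclusion. *)
have dpm : 3 * (4 * p + m) <= 5 * d by rewrite /d -/p -/m; lia.
have E2 : p * ((4 * p + m) * P - d ^+ 2 * s2 ^+ 2) =
    ((4 * p + m) * (z3 * s1 + z1 * s3) - 4 * p * (z2 * s2)) ^+ 2
    + ((4 * p - m) * (4 * p + m)) * (z3 * s1 - z1 * s3) ^+ 2.
  by rewrite /P /d /p /m; ring.
have E1 : p * (4 * p + m) * P - 2 * d ^+ 2 * (z3 ^+ 2 * s1 ^+ 2 + z1 ^+ 2 * s3 ^+ 2)
   = 2 * m * d * (z3 * s1 - z1 * s3) ^+ 2
     + p * (4 * z2 * (z3 * s1 + z1 * s3) - (4 * p + m) * s2) ^+ 2.
  by rewrite /P /d /p /m; ring.
have H2 : d ^+ 2 * s2 ^+ 2 <= (4 * p + m) * P.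
  rewrite -subr_ge0 -(@pmulr_rge0 _ p) // E2 addr_ge0 ?sqr_ge0 //.
  by rewrite mulr_ge0 ?sqr_ge0 // mulr_ge0 // ltW.
have H1 : 2 * d ^+ 2 * (z3 ^+ 2 * s1 ^+ 2 + z1 ^+ 2 * s3 ^+ 2) <= p * (4 * p + m) * P.
  rewrite -subr_ge0 E1 addr_ge0 // mulr_ge0 ?sqr_ge0 ?(ltW p_gt0) //.
  by rewrite mulr_ge0 ?(ltW d_gt0) // mulr_ge0.
have P_ge0 : 0 <= P.
  rewrite -(@pmulr_rge0 _ (4 * p + m)) //; apply: le_trans H2.
  by rewrite mulr_ge0 ?sqr_ge0.
have H : 3 * (4 * p + m) * P <= 5 * d * P.
  by rewrite ler_wpM2r.
split; rewrite -(@ler_pM2l _ d) //.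
  rewrite (_ : d * (3 * d * s2 ^+ 2) = 3 * (d ^+ 2 * s2 ^+ 2)); last by ring.
  rewrite (_ : d * (5 * P) = 5 * d * P); last by ring.
  by apply: le_trans H; rewrite -mulrA ler_pM2l.
have -> : d * (6 * d * (z3 ^+ 2 * s1 ^+ 2 + z1 ^+ 2 * s3 ^+ 2)) =
  3 * (2 * d ^+ 2 * (z3 ^+ 2 * s1 ^+ 2 + z1 ^+ 2 * s3 ^+ 2)) by ring.
have -> : d * (5 * p * P) = p * (5 * d * P) by ring.
apply: (@le_trans _ _ (p * (3 * (4 * p + m) * P))); last by rewrite ler_pM2l.
have -> : p * (3 * (4 * p + m) * P) = 3 * (p * (4 * p + m) * P) by ring.
by rewrite ler_pM2l.
Qed.

Lemma polar_tqmx q x y : polar q x y = \sum_i (tqmx q *m x) i 0 * y i 0.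
Proof. by rewrite !sum3 !mxE !sum3 !mxE /= /polar; ring. Qed.

Lemma polar_delta q x i : polar q x (delta_mx i 0) = (tqmx q *m x) i 0.
Proof.
rewrite polar_tqmx (bigD1 i) //= big1 => [|j ji]; rewrite [delta_mx _ _ _ _]mxE.
  by rewrite !eqxx mulr1 addr0.
by rewrite (negPf ji) mulr0.
Qed.

Definition grad2 q x : int := \sum_i (tqmx q *m x) i 0 ^+ 2.

(** [reduced_majorant] is applied to each standard basis vector and summed. The majorants add up to
    [|Q e| ^ 2 - q(e) tr Q], which is at most [10 B q(e)]. *)
Lemma frame_bounds q (D B : int) a b c e : 0 < D -> 0 < B -> frame q D a b c ->
  (forall i, `|tqmx q i i| <= B) -> grad2 q e < 7 * B * tqeval q e ->
  polar q b e ^+ 2 <= polar q a e * polar q c e ->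
  3 * grad2 q b <= 100 * (D * B) /\
  9 * (grad2 q c * grad2 q a) <= 625 * (D * B) ^+ 2.
Proof.
move=> D0 B0 F hB ge red.
have E0 : 0 < tqeval q e.
  have B7 : 0 < 7 * B by rewrite mulr_gt0.
  rewrite -(pmulr_rgt0 _ B7); apply: le_lt_trans ge.
  by apply: sumr_ge0 => i _; apply: sqr_ge0.
have pos := frame_polar e e D0 F; rewrite polarxx in pos.
set E := tqeval q e in ge E0 pos.
set z1 := polar q c e in red pos; set z3 := polar q a e in red pos.
set z2 := polar q b e in red pos; rewrite [z3 * z1]mulrC in red pos.
set d := 4 * (z1 * z3) - z2 ^+ 2.
have dE : d = 4 * (D * E).
  have -> : 4 * (D * E) = 2 * D * (2 * E) by ring.
  by rewrite pos /d; ring.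
have DE0 : 0 < D * E by rewrite mulr_gt0.
have p_gt0 : 0 < z1 * z3 by have := sqr_ge0 z2; rewrite /d in dE; lia.
pose P i := 8 * D ^+ 2 * ((tqmx q *m e) i 0 ^+ 2 - E * tqmx q i i).
have step i : 3 * d * (tqmx q *m b) i 0 ^+ 2 <= 5 * P i /\
    6 * d * (z3 ^+ 2 * (tqmx q *m c) i 0 ^+ 2 + z1 ^+ 2 * (tqmx q *m a) i 0 ^+ 2)
      <= 5 * (z1 * z3) * P i.
  pose x : 'cV[int]_3 := delta_mx i 0.
  have xe := frame_polar x e D0 F; have xx := frame_polar x x D0 F.
  rewrite polarC !polar_delta -/z1 -/z2 -/z3 in xe.
  have xxE : polar q x x = tqmx q i i.
    rewrite polar_delta mxE (bigD1 i) //= big1 => [|j ji].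
      by rewrite [X in _ * X]mxE !eqxx mulr1 addr0.
    by rewrite [X in _ * X]mxE (negPf ji) mulr0.
  rewrite xxE !polar_delta in xx.
  have := reduced_majorant ((tqmx q *m c) i 0) ((tqmx q *m b) i 0)
    ((tqmx q *m a) i 0) p_gt0 red.
  rewrite /= -/d.
  have -> : 2 * z3 * (tqmx q *m c) i 0 + 2 * z1 * (tqmx q *m a) i 0 -
     z2 * (tqmx q *m b) i 0 = 2 * D * (tqmx q *m e) i 0 by rewrite xe; ring.
  have -> : 4 * ((tqmx q *m c) i 0 * (tqmx q *m a) i 0) - (tqmx q *m b) i 0 ^+ 2
     = 2 * D * tqmx q i i by rewrite xx; ring.
  by rewrite (_ : _ - _ = P i) // /P dE; ring.
have sumP : \sum_i P i <= 80 * D * (D * E) * B.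
  rewrite -mulr_sumr sumrB -mulr_sumr.
  have tr : - (3 * B) <= \sum_i tqmx q i i.
    by rewrite sum3; have := hB 0; have := hB 1; have := hB 2; lia.
  rewrite -/(grad2 q e).
  have -> : 80 * D * (D * E) * B = 8 * D ^+ 2 * (10 * (E * B)) by ring.
  rewrite ler_pM2l; last by rewrite mulr_gt0 // exprn_gt0.
  have : E * - (3 * B) <= E * \sum_i tqmx q i i by rewrite ler_pM2l.
  have -> : E * - (3 * B) = - (3 * (E * B)) by ring.
  move: ge; have -> : 7 * B * E = 7 * (E * B) by ring.
  by move: (grad2 q e) (E * B) (E * \sum_i tqmx q i i) => s t u; lia.
split.
  rewrite -(@ler_pM2l _ (4 * (D * E))) ?mulr_gt0 //.
  have -> : 4 * (D * E) * (3 * grad2 q b) = \sum_i 3 * d * (tqmx q *m b) i 0 ^+ 2.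
    by rewrite -mulr_sumr -/(grad2 q b) dE; ring.
  apply: (@le_trans _ _ (\sum_i 5 * P i)).
    by apply: ler_sum => i _; case: (step i).
  by rewrite -mulr_sumr; move: sumP; lia.
have H : 3 * (z3 ^+ 2 * grad2 q c + z1 ^+ 2 * grad2 q a) <= 50 * (z1 * z3) * (D * B).
  rewrite -(@ler_pM2l _ (8 * (D * E))) ?mulr_gt0 //.
  have -> : 8 * (D * E) * (3 * (z3 ^+ 2 * grad2 q c + z1 ^+ 2 * grad2 q a)) =
    \sum_i 6 * d * (z3 ^+ 2 * (tqmx q *m c) i 0 ^+ 2 + z1 ^+ 2 * (tqmx q *m a) i 0 ^+ 2).
    by rewrite -mulr_sumr big_split /= -!mulr_sumr -/(grad2 q c) -/(grad2 q a) dE; ring.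
  apply: (@le_trans _ _ (\sum_i 5 * (z1 * z3) * P i)).
    by apply: ler_sum => i _; case: (step i).
  rewrite -mulr_sumr.
  have -> : 8 * (D * E) * (50 * (z1 * z3) * (D * B)) =
     5 * (z1 * z3) * (80 * D * (D * E) * B) by ring.
  by rewrite ler_pM2l // mulr_gt0.
have gc : 0 <= grad2 q c by apply: sumr_ge0 => i _; apply: sqr_ge0.
have ga : 0 <= grad2 q a by apply: sumr_ge0 => i _; apply: sqr_ge0.
(* The inequality [4 s t <= (s + t) ^ 2] turns the weighted sum into a bound on the product; the
   weights multiply to [(z1 z3) ^ 2], which cancels. *)
rewrite -(@ler_pM2l _ (4 * (z1 * z3) ^+ 2)); last by rewrite mulr_gt0 ?exprn_gt0.
apply: (@le_trans _ _ ((3 * (z3 ^+ 2 * grad2 q c + z1 ^+ 2 * grad2 q a)) ^+ 2)).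
  rewrite -subr_ge0 (_ : _ - _ =
    (3 * (z3 ^+ 2 * grad2 q c - z1 ^+ 2 * grad2 q a)) ^+ 2) ?sqr_ge0 //; ring.
have -> : 4 * (z1 * z3) ^+ 2 * (625 * (D * B) ^+ 2) = (50 * (z1 * z3) * (D * B)) ^+ 2.
  by ring.
have DB0 : 0 < D * B by rewrite mulr_gt0.
apply: lerXn2r => //; rewrite nnegrE mulr_ge0 ?(ltW DB0) //.
  by rewrite addr_ge0 // mulr_ge0 // sqr_ge0.
by rewrite mulr_ge0 // ltW.
Qed.

(** * Euclidean norms *)

Lemma fnorm_ge0 (R : rcfType) m n (A : 'M[R]_(m, n)) : 0 <= fnorm A.
Proof. exact: sqrtr_ge0. Qed.

Lemma sqr_fnorm (R : rcfType) m n (A : 'M[R]_(m, n)) :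
  fnorm A ^+ 2 = \sum_i \sum_j A i j ^+ 2.
Proof.
by rewrite sqr_sqrtr //; do 2!apply: sumr_ge0 => ? _; apply: sqr_ge0.
Qed.

Lemma fnormN (R : rcfType) m n (A : 'M[R]_(m, n)) : fnorm (- A) = fnorm A.
Proof.
rewrite /fnorm; congr Num.sqrt; do 2!apply: eq_bigr => ? _.
by rewrite mxE sqrrN.
Qed.

Lemma ler_sqrP (R : rcfType) (x y : R) : 0 <= y -> x ^+ 2 <= y ^+ 2 -> x <= y.
Proof.
move=> y0; have [x0 _|x0] := ltP x 0; first exact: le_trans (ltW x0) y0.
by rewrite ler_pXn2r.
Qed.

Definition cross (R : rcfType) (W : 'M[R]_3) (i j : 'I_3) : 'cV[R]_3 :=
  \col_k (if k == 0 then W i 1 * W j 2 - W i 2 * W j 1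
          else if k == 1 then W i 2 * W j 0 - W i 0 * W j 2
          else W i 0 * W j 1 - W i 1 * W j 0).

(** By Lagrange's identity the squares of the two sides differ by the square of the scalar
    product. *)
Lemma fnorm_cross (R : rcfType) (W : 'M[R]_3) i j :
  fnorm (cross W i j) <= fnorm (row i W) * fnorm (row j W).
Proof.
apply: ler_sqrP; first by rewrite mulr_ge0 ?fnorm_ge0.
rewrite exprMn !sqr_fnorm sum3 !big_ord1 !sum3 !mxE /= -subr_ge0.
have dot2 := sqr_ge0 (W i 0 * W j 0 + W i 1 * W j 1 + W i 2 * W j 2).
by congr (0 <= _): dot2; ring.
Qed.

(** These cross products are the columns of the adjugate of [W]. *)
Lemma mulmx_cross (R : rcfType) (W : 'M[R]_3) :
  [/\ W *m cross W 1 2 = \det W *: delta_mx 0 0,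
      W *m cross W 2 0 = \det W *: delta_mx 1 0 &
      W *m cross W 0 1 = \det W *: delta_mx 2 0].
Proof.
split; apply/matrixP; apply: ord3P => j; rewrite ord1 !mxE sum3 !mxE /= det3;
by ring.
Qed.

Lemma fnormZ (R : rcfType) m n (s : R) (A : 'M[R]_(m, n)) :
  fnorm (s *: A) = `|s| * fnorm A.
Proof.
apply/eqP; rewrite -(@eqrXn2 _ 2) ?mulr_ge0 ?fnorm_ge0 // exprMn !sqr_fnorm.
rewrite real_normK ?num_real // mulr_sumr; apply/eqP; apply: eq_bigr => i _.
by rewrite mulr_sumr; apply: eq_bigr => j _; rewrite mxE exprMn.
Qed.

(** The columns of [M] are [det M] times cross products of rows of its inverse. *)
Lemma fnorm_col_inv (R : rcfType) (M W : 'M[R]_3) : W *m M = 1%:M -> 0 < \det M ->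
  [/\ fnorm (col 0 M) <= \det M * (fnorm (row 1 W) * fnorm (row 2 W)),
      fnorm (col 1 M) <= \det M * (fnorm (row 2 W) * fnorm (row 0 W)) &
      fnorm (col 2 M) <= \det M * (fnorm (row 0 W) * fnorm (row 1 W))].
Proof.
move=> WM dM; have MW := mulmx1C WM.
have dWM : \det W * \det M = 1 by rewrite -det_mulmx WM det1.
have key (i j k : 'I_3) : W *m cross W i j = \det W *: delta_mx k 0 ->
    fnorm (col k M) <= \det M * (fnorm (row i W) * fnorm (row j W)).
  move=> /(congr1 (mulmx M)); rewrite mulmxA MW mul1mx -scalemxAr -colE => cE.
  have -> : col k M = \det M *: cross W i j.
    by rewrite cE scalerA mulrC dWM scale1r.
  by rewrite fnormZ gtr0_norm // ler_pM2l // fnorm_cross.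
by have [E0 E1 E2] := mulmx_cross W; split; apply: key.
Qed.

(** By the pairings in a frame, the rows of the inverse are the transposes of [Q c / D],
    [- Q b / (2 D)] and [Q a / D]. *)
Lemma frame_inverse (R : rcfType) q (D : int) a b c : 0 < D -> frame q D a b c ->
  let W := invmx (mxR R (mx3 a b c)) in
  [/\ W *m mxR R (mx3 a b c) = 1%:M,
      fnorm (row 0 W) ^+ 2 = (grad2 q c)%:~R / D%:~R ^+ 2,
      fnorm (row 1 W) ^+ 2 = (grad2 q b)%:~R / (2 * D%:~R) ^+ 2 &
      fnorm (row 2 W) ^+ 2 = (grad2 q a)%:~R / D%:~R ^+ 2].
Proof.
move=> D0 F W.
have DR0 : D%:~R != 0 :> R by rewrite intr_eq0 gt_eqF.
pose v (i : 'I_3) := if i == 0 then c else if i == 1 then b else a.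
pose s (i : 'I_3) : R := if i == 1 then - (2 * D%:~R)^-1 else D%:~R^-1.
pose W' : 'M[R]_3 := \matrix_(i, j) (s i * ((tqmx q *m v i) j 0)%:~R).
have W'M : W' *m mxR R (mx3 a b c) = 1%:M.
  apply/matrixP=> i k.
  have -> : (W' *m mxR R (mx3 a b c)) i k = s i * (polar q (v i) (col k (mx3 a b c)))%:~R.
    rewrite mxE polar_tqmx rmorph_sum mulr_sumr /=; apply: eq_bigr => j _.
    by rewrite !mxE rmorphM /= mulrA.
  case: F => qa qc qb [ab bc ac].
  have [ba [cb ca]] : polar q b a = 0 /\ polar q c b = 0 /\ polar q c a = D.
    by rewrite !(polarC _ _ a) (polarC _ c b).
  have -> : (1%:M : 'M[R]_3) i k = (i == k)%:R by rewrite mxE.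
  move: i k; apply: ord3P; apply: ord3P.
  all: rewrite /s /v ?col0_mx3 ?col1_mx3 ?col2_mx3 /=.
  all: rewrite ?polarxx ?qa ?qb ?qc ?ab ?ba ?ac ?ca ?bc ?cb ?mulr0 ?mulVf //.
  by rewrite rmorphM rmorphN /=; field.
have WE : W = W'.
  have [_ uM] := mulmx1_unit W'M.
  by rewrite /W -[invmx _]mul1mx -W'M -mulmxA mulmxV // mulmx1.
have norm_row i : fnorm (row i W') ^+ 2 = s i ^+ 2 * (grad2 q (v i))%:~R.
  rewrite sqr_fnorm big_ord1 rmorph_sum mulr_sumr /=; apply: eq_bigr => j _.
  by rewrite !mxE exprMn rmorphXn.
rewrite WE; split=> //; rewrite norm_row /s /v /= mulrC.
- by rewrite exprVn.
- by rewrite sqrrN exprVn.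
- by rewrite exprVn.
Qed.

Lemma frame_norm_bounds (R : rcfType) q (D B : int) a b c : 0 < D -> 0 < B ->
  frame q D a b c -> B ^+ 2 <= \sum_i \sum_j tqmx q i j ^+ 2 ->
  3 * grad2 q b <= 100 * (D * B) ->
  9 * (grad2 q c * grad2 q a) <= 625 * (D * B) ^+ 2 ->
  let W := invmx (mxR R (mx3 a b c)) in
  fnorm (row 0 W) * fnorm (row 2 W) <= 9 * D%:~R^-1 * tqnorm R q /\
  fnorm (row 1 W) ^+ 2 <= 10 * D%:~R^-1 * tqnorm R q.
Proof.
move=> D0 B0 F hB hb hca W; have [_ W0 W1 W2] := frame_inverse R D0 F.
have DR0 : 0 < D%:~R :> R by rewrite ltr0z.
have BR0 : 0 < B%:~R :> R by rewrite ltr0z.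
have hBR : B%:~R <= tqnorm R q.
  apply: ler_sqrP; first exact: fnorm_ge0.
  rewrite sqr_fnorm -rmorphXn /=.
  have -> : \sum_i \sum_j (mxR R (tqmx q)) i j ^+ 2 =
      (\sum_i \sum_j tqmx q i j ^+ 2)%:~R.
    rewrite rmorph_sum /=; apply: eq_bigr => i _.
    by rewrite rmorph_sum /=; apply: eq_bigr => j _; rewrite mxE rmorphXn.
  by rewrite ler_int.
have n0 := fnorm_ge0 (mxR R (tqmx q)); rewrite -/(tqnorm R q) in n0.
have up (k l : R) : 0 <= k -> k <= l -> k * D%:~R^-1 * B%:~R <= l * D%:~R^-1 * tqnorm R q.
  move=> k0 kl; apply: ler_pM => //.
  - by rewrite mulr_ge0 // invr_ge0 ltW.
  - exact: ltW.
  - by rewrite ler_pM2r ?invr_gt0.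
split.
  (* [25 / 3] is the square root of [625 / 9]. *)
  apply: le_trans (up (25 / 3) 9 _ _); last by lra. 2: by lra.
  apply: ler_sqrP; first by rewrite !mulr_ge0 ?invr_ge0 ?(ltW DR0) ?(ltW BR0) //; lra.
  rewrite exprMn W0 W2 mulrACA -rmorphM /= -invfM.
  have : 9 * (grad2 q c * grad2 q a)%:~R <= 625 * (D%:~R * B%:~R) ^+ 2 :> R.
    by rewrite -(ler_int R) !rmorphM /= in hca; rewrite !rmorphM.
  rewrite ler_pdivrMr ?mulr_gt0 ?exprn_gt0 // => hca'.
  have -> : (25 / 3 / D%:~R * B%:~R) ^+ 2 * (D%:~R ^+ 2 * D%:~R ^+ 2) =
    (625 * (D%:~R * B%:~R) ^+ 2) / 9 :> R by field; rewrite gt_eqF.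
  by rewrite ler_pdivlMr // mulrC.
(* Here [25 / 3] is [100 / 3] divided by the 4 of [(2 D) ^ 2]. *)
rewrite W1; apply: le_trans (up (25 / 3) 10 _ _); last by lra. 2: by lra.
have hb' : 3 * (grad2 q b)%:~R <= 100 * (D%:~R * B%:~R) :> R.
  by rewrite -(ler_int R) !rmorphM /= in hb.
rewrite ler_pdivrMr ?exprn_gt0 ?mulr_gt0 //.
have -> : 25 / 3 / D%:~R * B%:~R * (2 * D%:~R) ^+ 2 =
    (100 * (D%:~R * B%:~R)) / 3 :> R by field; rewrite gt_eqF.
by rewrite ler_pdivlMr // mulrC.
Qed.

(** * Oriented reduced frames and the final assembly *)

Lemma grad2N q x : grad2 q (- x) = grad2 q x.
Proof. by apply: eq_bigr => i _; rewrite mulmxN mxE sqrrN. Qed.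

Lemma mxRN (R : rcfType) m n (A : 'M[int]_(m, n)) : mxR R (- A) = - mxR R A.
Proof. by apply/matrixP=> i j; rewrite !mxE rmorphN. Qed.

Lemma det_mx3N a b c : \det (mx3 (- a) (- b) (- c)) = - \det (mx3 a b c).
Proof. by rewrite !det3 !mxE /=; ring. Qed.

Lemma col_mxR3 (R : rcfType) a b c :
  [/\ col 0 (mxR R (mx3 a b c)) = mxR R a, col 1 (mxR R (mx3 a b c)) = mxR R b
    & col 2 (mxR R (mx3 a b c)) = mxR R c].
Proof. by rewrite /mxR -!map_col col0_mx3 col1_mx3 col2_mx3. Qed.

(** Exchanging the isotropic columns orders their lengths, and negating all three columns changes
    the sign of the determinant; both moves preserve the lattice and the bounds. *)
Lemma oriented_reduced_frame (R : rcfType) q (D : int) a b c : 0 < tqdisc q ->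
  0 < D -> frame q D a b c -> exists B a' b' c',
  [/\ [/\ 0 < B, B ^+ 2 <= \sum_i \sum_j tqmx q i j ^+ 2,
          3 * grad2 q b' <= 100 * (D * B) &
          9 * (grad2 q c' * grad2 q a') <= 625 * (D * B) ^+ 2],
      frame q D a' b' c', 0 < \det (mx3 a' b' c'),
      fnorm (mxR R a') <= fnorm (mxR R c') &
      forall x, in_lattice (mx3 a' b' c') x <-> in_lattice (mx3 a b c) x].
Proof.
move=> disc_gt0 D0 F0.
have [B [B0 hB B2]] := exists_entry_bound disc_gt0.
have [e he] := positive_vector disc_gt0 B0 hB.
have qe : 0 < tqeval q e.
  have B7 : 0 < 7 * B by rewrite mulr_gt0.
  rewrite -(pmulr_rgt0 _ B7); apply: le_lt_trans he.
  by apply: sumr_ge0 => i _; apply: sqr_ge0.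
have [a1 [b1 [c1 [F1 L1 red]]]] := reduced_frame D0 F0 qe.
have [hb hca] := frame_bounds D0 B0 F1 (fun i => hB i i) he red.
have [a2 [b2 [c2 [[{}hb {}hca] F2 hac L2]]]] : exists a' b' c',
    [/\ 3 * grad2 q b' <= 100 * (D * B) /\
        9 * (grad2 q c' * grad2 q a') <= 625 * (D * B) ^+ 2,
      frame q D a' b' c', fnorm (mxR R a') <= fnorm (mxR R c') &
      forall x, in_lattice (mx3 a' b' c') x <-> in_lattice (mx3 a b c) x].
  have [le_ac|/ltW le_ca] := lerP (fnorm (mxR R a1)) (fnorm (mxR R c1)).
    by exists a1, b1, c1.
  exists c1, (- b1), a1; split=> //; first by rewrite grad2N [grad2 q a1 * _]mulrC.
    exact: frame_swap.
  by move=> x; rewrite in_lattice_swap L1.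
have d0 := frame_det_neq0 D0 F2.
exists B; have [d_gt0|d_le0] := ltP 0 (\det (mx3 a2 b2 c2)).
  by exists a2, b2, c2.
exists (- a2), (- b2), (- c2); rewrite !grad2N !mxRN !fnormN det_mx3N; split=> //.
- exact: frame_N.
- by rewrite oppr_gt0 lt_neqAle d0.
- by move=> x; rewrite in_lattice_opp L2.
Qed.

Lemma reduced_lattice (R : rcfType) q (D : int) a b c : tqprimitive q ->
  0 < tqdisc q -> 0 < D -> (D %| tqdisc q)%Z -> frame q D a b c ->
  exists M : 'M[int]_3,
  [/\ forall x, in_lattice M x <-> in_lattice (mx3 a b c) x,
      [/\ 0 < \det M, (\det M %| tqdisc q)%Z,
          forall x, tqeval q (M *m x) = D * (x 0 0 * x 2 0 - x 1 0 ^+ 2),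
          tqdisc q * \det M ^+ 2 = D ^+ 3 &
          [/\ (\det M %| D)%Z, (D %| \det M ^+ 2)%Z &
            forall p : nat, prime p -> (p%:Z %| (tqdisc q %/ \det M)%Z)%Z ->
              (4 <= logn p `|tqdisc q|)%N]],
      (let Minv := invmx (mxR R M) in
       fnorm (row 0 Minv) * fnorm (row 2 Minv) <= 9 * D%:~R^-1 * tqnorm R q
       /\ fnorm (row 1 Minv) ^+ 2 <= 10 * D%:~R^-1 * tqnorm R q) &
      (let c j := fnorm (col j (mxR R M)) in
       let d : R := (\det M)%:~R in
       [/\ c 0 <= c 2,
           c 0 * c 2 <= 90 * d ^+ 2 * D%:~R ^- 2 * tqnorm R q ^+ 2
             <= 90 * tqnorm R q ^+ 2 &
           c 1 <= 9 * d * D%:~R^-1 * tqnorm R q <= 9 * tqnorm R q])].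
Proof.
move=> pq disc_gt0 D0 D_dvd F0.
have [B [a' [b' [c' [[B0 B2 hb hca] F d_gt0 le_ac L]]]]] :=
  oriented_reduced_frame R disc_gt0 D0 F0.
have [ddisc dD p4] := frame_divisibility pq disc_gt0 D0 D_dvd F d_gt0.
have [WM _ _ _] := frame_inverse R D0 F.
have [h02 h1] := frame_norm_bounds R D0 B0 F B2 hb hca.
set M := mx3 a' b' c' in L d_gt0 ddisc dD p4 WM h02 h1 *.
exists M; split=> //.
  split=> //; first by move=> x; apply: (frame_eval _ F).
    exact: (frame_disc F).
  by split=> //; apply: (frame_dvd_det pq F).
have [c0E c1E c2E] := col_mxR3 R a' b' c'; rewrite -/M in c0E c1E c2E.
move=> nc d; set n := tqnorm R q in h02 h1 *; set W := invmx _ in WM h02 h1.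
have detM : \det (mxR R M) = d by rewrite /mxR det_map_mx.
have d0 : 0 < d by rewrite ltr0z.
have DR0 : 0 < D%:~R :> R by rewrite ltr0z.
have n0 : 0 <= n := fnorm_ge0 _.
(* As [det M] divides [D], this ratio is at most 1, which gives the second inequality in each pair
   of column bounds. *)
have le_dD : d / D%:~R <= 1.
  rewrite ler_pdivrMr // mul1r ler_int -[D]gtz0_abs // -[\det M]gtz0_abs // lez_nat.
  by apply: dvdn_leq => //; rewrite absz_gt0 gt_eqF.
have dD0 : 0 <= d / D%:~R by rewrite divr_ge0 // ltW.
have [h0 h1' h2] : [/\ nc 0 <= d * (fnorm (row 1 W) * fnorm (row 2 W)),
    nc 1 <= d * (fnorm (row 2 W) * fnorm (row 0 W)) &
    nc 2 <= d * (fnorm (row 0 W) * fnorm (row 1 W))].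
  by rewrite -detM; apply: fnorm_col_inv; rewrite ?detM.
split; first by rewrite /nc c0E c2E.
  apply/andP; split; last first.
    have -> : 90 * d ^+ 2 * D%:~R ^- 2 * n ^+ 2 = (d / D%:~R) ^+ 2 * (90 * n ^+ 2).
      by field; rewrite gt_eqF.
    rewrite -[leRHS]mul1r ler_wpM2r ?mulr_ge0 ?sqr_ge0 //.
    by rewrite expr_le1.
  apply: (le_trans (ler_pM (fnorm_ge0 _) (fnorm_ge0 _) h0 h2)).
  (* The bounds on the outer columns multiply to [d ^ 2] times the two quantities bounded in (b), so
     90 is 9 times 10. *)
  have -> : d * (fnorm (row 1 W) * fnorm (row 2 W)) *
     (d * (fnorm (row 0 W) * fnorm (row 1 W))) =
     d ^+ 2 * (fnorm (row 0 W) * fnorm (row 2 W) * fnorm (row 1 W) ^+ 2) by ring.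
  have -> : 90 * d ^+ 2 * D%:~R ^- 2 * n ^+ 2 =
     d ^+ 2 * (9 * D%:~R^-1 * n * (10 * D%:~R^-1 * n)).
    by field; rewrite gt_eqF.
  rewrite ler_wpM2l ?sqr_ge0 // ler_pM ?sqr_ge0 //.
  by rewrite mulr_ge0 ?fnorm_ge0.
apply/andP; split.
  apply: le_trans h1' _.
  have -> : 9 * d / D%:~R * n = d * (9 * D%:~R^-1 * n) by ring.
  by rewrite ler_wpM2l ?(ltW d0) // mulrC.
have -> : 9 * d / D%:~R * n = (d / D%:~R) * (9 * n) by ring.
by rewrite -[leRHS]mul1r ler_wpM2r ?mulr_ge0.
Qed.

(** The swap brings the first column into third place, where [frame_shift] can take out the factor
    [h]. *)
Lemma extremal_lattice_frame q D N a b c (h : nat) : extremal q D N a b c ->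
  (h %| N)%N -> frame q D ((N %/ h)%N%:Z *: a) b (h%:Z *: c).
Proof.
move=> E hN; have N_gt0 := ext_N_gt0 E.
have h0 : h%:Z != 0 by have := dvdn_gt0 N_gt0 hN; lia.
have := frame_swap (ext_frame E).
rewrite (_ : N%:Z *: a = h%:Z *: ((N %/ h)%N%:Z *: a)); last first.
  by rewrite scalerA -PoszM mulnC divnK.
by move/(frame_shift h0)/frame_swap; rewrite opprK.
Qed.

Theorem theorem2 (R : rcfType) (q : tqform)
    (q_prim : tqprimitive q) (q_iso : isotropic q) (Delta_gt0 : 0 < tqdisc q) :
  exists (K : nat) (M : 'I_K -> 'M[int]_3) (D : 'I_K -> int),
    [/\ (0 < K <= tau `|tqdisc q|)%N,
        (forall k, \det (M k) != 0) /\ (forall k, 0 < D k),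
        (* (a) *)
        [/\ powerfree 2 `|tqdisc q|%N -> K = tau `|tqdisc q|%N,
            (forall k, 0 < \det (M k) /\ (\det (M k) %| tqdisc q)%Z),
            (forall x : 'cV[int]_3, primitive_zero q x ->
               exists! k : 'I_K, in_lattice (M k) x),
            (forall k (x : 'cV[int]_3),
               tqeval q (M k *m x) = D k * (x 0 0 * x 2 0 - x 1 0 ^+ 2)) &
            [/\ (forall k, tqdisc q * \det (M k) ^+ 2 = D k ^+ 3),
                (forall k, [/\ (D k %| tqdisc q)%Z, (\det (M k) %| D k)%Z
                             & (D k %| \det (M k) ^+ 2)%Z]),
                (forall k (p : nat), prime p ->
                   (p%:Z %| (tqdisc q %/ \det (M k))%Z)%Z ->
                   (4 <= logn p `|tqdisc q|)%N) &
                (powerfree 3 `|tqdisc q|%N ->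
                   forall k, exists x : 'cV[int]_3,
                     primitive_zero q x /\ in_lattice (M k) x)]],
        (* (b) *)
        (forall k, let Minv := invmx (mxR R (M k)) in
           fnorm (row 0 Minv) * fnorm (row 2 Minv)
             <= 9 * (D k)%:~R^-1 * tqnorm R q
           /\ fnorm (row 1 Minv) ^+ 2 <= 10 * (D k)%:~R^-1 * tqnorm R q) &
        (* (c) *)
        (forall k, let c j := fnorm (col j (mxR R (M k))) in
           let d : R := (\det (M k))%:~R in
           [/\ c 0 <= c 2,
               c 0 * c 2 <= 90 * d ^+ 2 * (D k)%:~R ^- 2 * tqnorm R q ^+ 2
                 <= 90 * tqnorm R q ^+ 2 &
               c 1 <= 9 * d * (D k)%:~R^-1 * tqnorm R q <= 9 * tqnorm R q])].
Proof.
have [D [N [a [b [c E]]]]] := exists_extremal q_iso Delta_gt0.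
have D0 := ext_D_gt0 E; have D_dvd := ext_D_dvd E; have N0 := ext_N_gt0 E.
(* There is one lattice for each divisor of [N], so [K = tau(N)]. *)
pose h (k : 'I_(tau N)) := nth 0%N (divisors N) k.
have hN k : (h k %| N)%N.
  by rewrite dvdn_divisors // mem_nth.
have hK (m : nat) : (m %| N)%N -> exists k, h k = m.
  rewrite dvdn_divisors // -index_mem => lt_m.
  by exists (Ordinal lt_m); rewrite /h /= nth_index // -index_mem.
have h_inj : injective h.
  move=> k l /eqP; rewrite nth_uniq ?divisors_uniq // => /eqP; exact: val_inj.
have /fin_all_exists[M HM] := fun k =>
  reduced_lattice R q_prim Delta_gt0 D0 D_dvd (extremal_lattice_frame E (hN k)).
have inM k x : in_lattice (M k) x <-> in_lattice (lattice_mx N (h k) a b c) x.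
  by have [HL _ _ _] := HM k; apply: HL.
have M_gt0 k : 0 < \det (M k) by have [_ [? _ _ _ _] _ _] := HM k.
(* [N] divides [D = N polar q a c], which divides the discriminant; this gives the upper bound on
   [K]. *)
have N_dvd : (N %| `|tqdisc q|)%N.
  apply: dvdn_trans (D_dvd : (`|D| %| _)%N).
  by have [_ _ _ [_ _ <-]] := ext_frame E; rewrite polarZl abszM dvdn_mulr.
exists (tau N), M, (fun=> D); split.
- apply/andP; split.
    by rewrite /tau -has_predT; apply/hasP; exists 1%N; rewrite // -dvdn_divisors.
  apply: uniq_leq_size; first exact: divisors_uniq.
  move=> m; rewrite -!dvdn_divisors ?absz_gt0 ?gt_eqF // => mN.
  exact: dvdn_trans N_dvd.
- by split=> // k; rewrite gt_eqF.
- split.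
  + by move=> sf; rewrite (extremal_squarefree q_prim Delta_gt0 E sf).
  + by move=> k; have [_ [? ? _ _ _] _ _] := HM k.
  + move=> x zx; have [m [mN mx m_uniq]] := lattice_unique E zx.
    have [k hk] := hK m mN; exists k; split; first by apply/inM; rewrite hk.
    by move=> l /inM lx; apply: h_inj; rewrite hk (m_uniq _ (hN l) lx).
  + by move=> k; have [_ [_ _ ? _ _] _ _] := HM k.
  + split.
    * by move=> k; have [_ [_ _ _ ? _] _ _] := HM k.
    * by move=> k; have [_ [_ _ _ _ [? ? _]] _ _] := HM k.
    * by move=> k; have [_ [_ _ _ _ [_ _ ?]] _ _] := HM k.
    * move=> _ k; have [x [zx lx]] := lattice_meets E (hN k).
      by exists x; split=> //; apply/inM.
- by move=> k; have [_ _ ? _] := HM k.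
- by move=> k; have [_ _ _ ?] := HM k.
Qed.
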